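(* Let $\mathcal{CPZ}_1 = \langle c_1,G_1,E_1,A_1,b_1,R_1 \rangle_{CPZ}$ and $\mathcal{CPZ}_2 = \langle c_2,G_2,E_2,A_2,b_2,R_2 \rangle_{CPZ}$ be regular constrained polynomial zonotopes in $\mathbb{R}^n$, where $E_j \in \mathbb{Z}_{\ge0}^{p_j\times h_j}$, $A_j \in \mathbb{R}^{m_j\times q_j}$, $R_j \in \mathbb{Z}_{\ge0}^{p_j \times q_j}$ ($j=1,2$). Set $p = p_1+p_2+2$ and define $$c = \tfrac12(c_1+c_2),\quad G = \begin{bmatrix} \tfrac12(c_1-c_2) & G_1 & G_2 \end{bmatrix},\quad E = \begin{bmatrix} 1 & \mathbf{0} & \mathbf{0} \\ 0 & \mathbf{0} & \mathbf{0} \\ \mathbf{0} & E_1 & \mathbf{0} \\ \mathbf{0} & \mathbf{0} & E_2 \end{bmatrix} \in \mathbb{Z}_{\ge 0}^{p\times(1+h_1+h_2)},$$ $$A = \begin{bmatrix} \widehat{A} & \mathbf{0} & \mathbf{0} & \mathbf{0} & 0 \\ \mathbf{0} & \overline{A} & \mathbf{0} & \mathbf{0} & 0 \\ \mathbf{0} & \mathbf{0} & A_1 & \mathbf{0} & -\tfrac12 b_1 \\ \mathbf{0} & \mathbf{0} & \mathbf{0} & A_2 & \tfrac12 b_2 \end{bmatrix},\quad b = \begin{bmatrix} \widehat{b} \\ \overline{b} \\ \tfrac12 b_1 \\ \tfrac12 b_2 \end{bmatrix},\quad R = \begin{bmatrix} \widehat{R} & \overline{R} & \begin{bmatrix} \mathbf{0}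 & \mathbf{0} & 1 \\ \mathbf{0} & \mathbf{0} & 0 \\ R_1 & \mathbf{0} & \mathbf{0} \\ \mathbf{0} & R_2 & \mathbf{0} \end{bmatrix} \end{bmatrix},$$ where $\widehat{A} = 1$, $\widehat{b} = 1$, $\widehat{R} = [1~1~\mathbf{0}]^T \in \mathbb{Z}_{\ge 0}^{p}$, $\overline{b} = 0$, $$\overline{A} = \begin{bmatrix} 1 & -1 & \tfrac{1}{2p_1}\mathbf{1} & -\tfrac{1}{2p_1}\mathbf{1} & -\tfrac{1}{2p_2}\mathbf{1} & -\tfrac{1}{2p_2}\mathbf{1} & -\tfrac{1}{4p_1p_2}\mathbf{1} & \tfrac{1}{4p_1p_2}\mathbf{1} \end{bmatrix}$$ (the row blocks $\mathbf{1}$ having lengths $p_1,p_1,p_2,p_2,p_1p_2,p_1p_2$ respectively), and $$\overline{R} = \begin{bmatrix} \begin{bmatrix} 1 & 0 & \mathbf{0} & \mathbf{1} & \mathbf{0} & \mathbf{1} \\ 0 & 1 & \mathbf{0} & \mathbf{0} & \mathbf{0} & \mathbf{0} \\ \mathbf{0} & \mathbf{0} & 2I_{p_1} & 2I_{p_1} & \mathbf{0} & \mathbf{0} \\ \mathbf{0} & \mathbf{0} & \mathbf{0} & \mathbf{0} & 2I_{p_2} & 2I_{p_2} \end{bmatrix} & \begin{bmatrix} \mathbf{0} \\ \mathbf{0} \\ H \end{bmatrix} & \begin{bmatrix} \mathbf{1} \\ \mathbf{0} \\ H \end{bmatrix} \end{bmatrix},$$ with $H \in \mathbb{Z}_{\ge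 0}^{(p_1+p_2)\times p_1p_2}$ whose first $p_1$ rows form the block-diagonal matrix with $p_1$ diagonal blocks each equal to the row vector $[2~\cdots~2]$ of length $p_2$, and whose last $p_2$ rows are $[2I_{p_2}~\cdots~2I_{p_2}]$ ($p_1$ copies). (In the last block of $R$, the first row is $q_1+q_2$ zeros followed by a $1$, the second row is all zeros, $R_1$ occupies rows $3,\dots,p_1+2$ and $R_2$ rows $p_1+3,\dots,p$.) Then $$\mathcal{CPZ}_1 \cup \mathcal{CPZ}_2 = \langle c, G, E, A, b, R \rangle_{CPZ}.$$ Computing this representation and subsequently merging identical constraint exponent columns (replacing the constraint exponent matrix by its distinct columns and summing the constraint generator columns sharing an exponent column) has complexity $\mathcal{O}((\mu_1+\mu_2)\mu_1\mu_2\log(\mu_1\mu_2))$ with respect to the representation sizes $\mu_1,\mu_2$ and $\mathcal{O}(n^3\log(n))$ with respect to the dimension $n$.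
   Context: For $c \in \mathbb{R}^n$, $G \in \mathbb{R}^{n \times h}$, $E \in \mathbb{Z}_{\geq 0}^{p \times h}$, $A \in \mathbb{R}^{m \times q}$, $b \in \mathbb{R}^m$, $R \in \mathbb{Z}_{\geq 0}^{p \times q}$, the constrained polynomial zonotope $\langle c,G,E,A,b,R \rangle_{CPZ}$ is the set $$\Big\{ c + \sum_{i=1}^{h} \Big( \prod_{k=1}^p \alpha_k^{E_{(k,i)}} \Big) G_{(\cdot,i)} ~\Big|~ \sum_{i=1}^{q} \Big( \prod_{k=1}^p \alpha_k^{R_{(k,i)}} \Big) A_{(\cdot,i)} = b,~ \alpha_1,\dots,\alpha_p \in [-1,1] \Big\}$$ (with $0^0=1$). It is regular if the columns of $E$ are pairwise distinct and nonzero and the columns of $R$ are pairwise distinct and nonzero. Its representation size is $\mu = (n+p)h + n + (m+p)q + m$. $\mathbf{0}$ and $\mathbf{1}$ denote matrices of zeros and ones of appropriate size, $I_k$ the $k\times k$ identity. Complexity counts binary arithmetic operations (including comparisons); concatenations and initializations are not counted. Complexity ''with respect to the dimension $n$'' is understood under the assumption that the numbers of factors, generators, constraints, and constraint generators of each input are constant multiples of $n$. *)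

(* Defs.v *)
From HB Require Import structures.
From mathcomp Require Import all_boot all_order all_algebra.
From mathcomp Require Import classical_sets reals exp.

Set Implicit Arguments.
Unset Strict Implicit.
Unset Printing Implicit Defensive.

Import Order.TTheory GRing.Theory Num.Theory.
Local Open Scope ring_scope.
Local Open Scope classical_set_scope.

(* The tuple <c, G, E, A, b, R>, over arbitrary types of coefficients and of
   exponents so that the same record also serves for the symbolic outputs of
   the programs below. *)
Record rep (T U : Type) (n p h m q : nat) := Rep {
  center : 'cV[T]_n;       (* c *)
  gens   : 'M[T]_(n, h);   (* G *)
  expo   : 'M[U]_(p, h);   (* E *)
  cgens  : 'M[T]_(m, q);   (* A *)
  coff   : 'cV[T]_m;       (* b *)
  cexpo  : 'M[U]_(p, q)    (* R *)
}.

Definition map_rep (T U T' U' : Type) (f : T -> T') (g : U -> U')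
    (n p h m q : nat) (Z : rep T U n p h m q) : rep T' U' n p h m q :=
  Rep (map_mx f (center Z)) (map_mx f (gens Z)) (map_mx g (expo Z))
      (map_mx f (cgens Z)) (map_mx f (coff Z)) (map_mx g (cexpo Z)).

Definition cpz (R : realType) (n p h m q : nat) := rep R nat n p h m q.

Definition monomial (R : realType) (p h : nat) (a : 'cV[R]_p)
    (E : 'M[nat]_(p, h)) (i : 'I_h) : R :=
  \prod_(k < p) a k 0 ^+ E k i.

Definition cpz_set (R : realType) (n p h m q : nat) (Z : cpz R n p h m q) :
    set 'cV[R]_n :=
  [set center Z + \sum_(i < h) monomial a (expo Z) i *: col i (gens Z)
  | a in [set a : 'cV[R]_p |
      \sum_(i < q) monomial a (cexpo Z) i *: col i (cgens Z) = coff Z /\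
      forall k, -1 <= a k 0 <= 1]].

Definition distinct_nonzero_cols (p h : nat) (E : 'M[nat]_(p, h)) : Prop :=
  injective (fun i => col i E) /\ forall i, col i E != 0.

Definition regular (R : realType) (n p h m q : nat) (Z : cpz R n p h m q) :
    Prop :=
  distinct_nonzero_cols (expo Z) /\ distinct_nonzero_cols (cexpo Z).

Definition rep_size (n p h m q : nat) : nat :=
  ((n + p) * h + n + (m + p) * q + m)%N.

Local Notation "A <|> B" := (row_mx A B) (at level 61, right associativity).
Local Notation "A </> B" := (col_mx A B) (at level 63, right associativity).

(* Blocks are nested to the right, so that p = p1 + p2 + 2 appears as
   1 + (1 + (p1 + p2)), and similarly for the other sizes. *)
Definition union_p (p1 p2 : nat) := (1 + (1 + (p1 + p2)))%N.
Definition union_h (h1 h2 : nat) := (1 + (h1 + h2))%N.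
Definition union_m (m1 m2 : nat) := (1 + (1 + (m1 + m2)))%N.
Definition bar_q (p1 p2 : nat) :=
  (1 + (1 + (p1 + (p1 + (p2 + (p2 + (p1 * p2 + p1 * p2)))))))%N.
Definition union_q (p1 p2 q1 q2 : nat) :=
  (1 + (bar_q p1 p2 + (q1 + (q2 + 1))))%N.

Definition union_E (p1 p2 h1 h2 : nat)
    (E1 : 'M[nat]_(p1, h1)) (E2 : 'M[nat]_(p2, h2)) :
    'M[nat]_(union_p p1 p2, union_h h1 h2) :=
      (const_mx 1%N <|> 0  <|> 0)
  </> (0            <|> 0  <|> 0)
  </> (0            <|> E1 <|> 0)
  </> (0            <|> 0  <|> E2).

Definition Rhat (p1 p2 : nat) : 'M[nat]_(union_p p1 p2, 1) :=
  const_mx 1%N </> const_mx 1%N </> 0.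

(* Columns are grouped in p1 consecutive blocks of length p2: column j lies in
   block j %/ p2, at position j %% p2. *)
Definition Hmx (p1 p2 : nat) : 'M[nat]_(p1 + p2, p1 * p2) :=
      (\matrix_(i < p1, j < p1 * p2) (if j %/ p2 == i then 2 else 0)%N)
  </> (\matrix_(i < p2, j < p1 * p2) (if j %% p2 == i then 2 else 0)%N).

Definition Rbar (p1 p2 : nat) : 'M[nat]_(union_p p1 p2, bar_q p1 p2) :=
  let I1 : 'M[nat]_p1 := 2%N%:M in
  let I2 : 'M[nat]_p2 := 2%N%:M in
  let H := Hmx p1 p2 in
      (const_mx 1%N </> 0            </> 0)
  <|> (0            </> const_mx 1%N </> 0)
  <|> (0            </> 0            </> I1 </> 0)
  <|> (const_mx 1%N </> 0            </> I1 </> 0)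
  <|> (0            </> 0            </> 0  </> I2)
  <|> (const_mx 1%N </> 0            </> 0  </> I2)
  <|> (0            </> 0            </> H)
  <|> (const_mx 1%N </> 0            </> H).

(* When p1 = 0 or p2 = 0 the blocks whose coefficient would divide by zero are
   empty. *)
Definition Abar (R : realType) (p1 p2 : nat) : 'rV[R]_(bar_q p1 p2) :=
  let u1 : R := 1 / (2 * p1%:R) in
  let u2 : R := 1 / (2 * p2%:R) in
  let u12 : R := 1 / (4 * p1%:R * p2%:R) in
  const_mx 1 <|> const_mx (- 1)
  <|> const_mx u1 <|> const_mx (- u1)
  <|> const_mx (- u2) <|> const_mx (- u2)
  <|> const_mx (- u12) <|> const_mx u12.

Definition union_A (R : realType) (p1 m1 q1 p2 m2 q2 : nat)
    (A1 : 'M[R]_(m1, q1)) (b1 : 'cV[R]_m1)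
    (A2 : 'M[R]_(m2, q2)) (b2 : 'cV[R]_m2) :
    'M[R]_(union_m m1 m2, union_q p1 p2 q1 q2) :=
      (const_mx 1 <|> 0           <|> 0  <|> 0  <|> 0)
  </> (0          <|> Abar R p1 p2 <|> 0  <|> 0  <|> 0)
  </> (0          <|> 0           <|> A1 <|> 0  <|> - (1 / 2) *: b1)
  </> (0          <|> 0           <|> 0  <|> A2 <|> (1 / 2) *: b2).

Definition union_b (R : realType) (m1 m2 : nat)
    (b1 : 'cV[R]_m1) (b2 : 'cV[R]_m2) : 'cV[R]_(union_m m1 m2) :=
  const_mx 1 </> 0 </> (1 / 2) *: b1 </> (1 / 2) *: b2.

Definition union_R (p1 q1 p2 q2 : nat)
    (R1 : 'M[nat]_(p1, q1)) (R2 : 'M[nat]_(p2, q2)) :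
    'M[nat]_(union_p p1 p2, union_q p1 p2 q1 q2) :=
  Rhat p1 p2 <|> Rbar p1 p2 <|>
    (    (0  <|> 0  <|> const_mx 1%N)
     </> (0  <|> 0  <|> 0)
     </> (R1 <|> 0  <|> 0)
     </> (0  <|> R2 <|> 0)).

Definition cpz_union (R : realType) (n p1 h1 m1 q1 p2 h2 m2 q2 : nat)
    (Z1 : cpz R n p1 h1 m1 q1) (Z2 : cpz R n p2 h2 m2 q2) :
    cpz R n (union_p p1 p2) (union_h h1 h2) (union_m m1 m2)
      (union_q p1 p2 q1 q2) :=
  Rep ((1 / 2) *: (center Z1 + center Z2))
      ((1 / 2) *: (center Z1 - center Z2) <|> gens Z1 <|> gens Z2)
      (union_E (expo Z1) (expo Z2))
      (union_A p1 p2 (cgens Z1) (coff Z1) (cgens Z2) (coff Z2))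
      (union_b (coff Z1) (coff Z2))
      (union_R (cexpo Z1) (cexpo Z2)).

(* The order of the columns of the merged matrices is left free. *)
Definition merged (R : realType) (n p h m q q' : nat)
    (Z : cpz R n p h m q) (Z' : cpz R n p h m q') : Prop :=
  [/\ [/\ center Z' = center Z, gens Z' = gens Z, expo Z' = expo Z &
          coff Z' = coff Z],
      injective (fun j => col j (cexpo Z')),
      forall i, exists j, col j (cexpo Z') = col i (cexpo Z),
      forall j, exists i, col i (cexpo Z) = col j (cexpo Z') &
      forall j, col j (cgens Z') =
        \sum_(i < q | col i (cexpo Z) == col j (cexpo Z')) col i (cgens Z)].

(* Programs are arithmetic computation trees.  An operand is a natural number
   constant, an input, or the result of the k-th arithmetic operation executed
   so far (counting from 0).  Arithmetic operations and comparisons cost 1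
   each; constants and the assembly of the output at a leaf, i.e. the
   initializations and the concatenations, are free.  The syntax is
   first-order, so a program can compute with its inputs or branch on them only
   through counted instructions. *)
Inductive operand (I : Type) :=
  | Const of nat
  | Input of I
  | Result of nat.

Inductive arith_op := Add | Sub | Mul | Div.

Inductive prog (I O : Type) :=
  | Ret of O
  | Arith of arith_op & operand I & operand I & prog I O
  | IfLe of operand I & operand I & prog I O & prog I O.

Definition arith (R : realType) (o : arith_op) (x y : R) : R :=
  match o with Add => x + y | Sub => x - y | Mul => x * y | Div => x / y end.

Definition oval (R : realType) (I : Type) (inp : I -> R) (res : seq R)
    (x : operand I) : R :=
  match x with Const k => k%:R | Input i => inp i | Result k => res`_k end.

Record outcome (R : realType) (O : Type) := Outcome {
  out     : O;
  results : seq R;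
  cost    : nat
}.

Fixpoint exec (R : realType) (I O : Type) (inp : I -> R) (t : prog I O)
    (res : seq R) (k : nat) : outcome R O :=
  match t with
  | Ret o => Outcome o res k
  | Arith o x y t' =>
      exec inp t' (rcons res (arith o (oval inp res x) (oval inp res y))) k.+1
  | IfLe x y t1 t2 =>
      if oval inp res x <= oval inp res y then exec inp t1 res k.+1
      else exec inp t2 res k.+1
  end.

Definition run (R : realType) (I O : Type) (inp : I -> R) (t : prog I O) :
    outcome R O := exec inp t [::] 0.

(* Exponents are read as the corresponding real numbers, so that programs work
   with a single sort of values. *)
Inductive entry (n p h m q : nat) :=
  | Center of 'I_n
  | Gens of 'I_n & 'I_h
  | Expo of 'I_p & 'I_h
  | Cgens of 'I_m & 'I_q
  | Coff of 'I_m
  | Cexpo of 'I_p & 'I_q.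

Definition entry_val (R : realType) (n p h m q : nat) (Z : cpz R n p h m q)
    (e : entry n p h m q) : R :=
  match e with
  | Center i => center Z i 0
  | Gens i j => gens Z i j
  | Expo k j => (expo Z k j)%:R
  | Cgens i j => cgens Z i j
  | Coff i => coff Z i 0
  | Cexpo k j => (cexpo Z k j)%:R
  end.

Definition union_input (n p1 h1 m1 q1 p2 h2 m2 q2 : nat) : Type :=
  (entry n p1 h1 m1 q1 + entry n p2 h2 m2 q2)%type.

Definition input_val (R : realType) (n p1 h1 m1 q1 p2 h2 m2 q2 : nat)
    (Z1 : cpz R n p1 h1 m1 q1) (Z2 : cpz R n p2 h2 m2 q2)
    (e : union_input n p1 h1 m1 q1 p2 h2 m2 q2) : R :=
  match e with inl e1 => entry_val Z1 e1 | inr e2 => entry_val Z2 e2 end.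

(* A leaf outputs the representation together with its merged form, whose
   number q' of constraint generators depends on the leaf. *)
Definition rep_output (X : Type) (n p h m q : nat) : Type :=
  (rep X X n p h m q * {q' : nat & rep X X n p h m q'})%type.

(* One program for each choice of the sizes: only operations on entries are
   counted, not those on indices. *)
Definition union_algorithm : Type :=
  forall n p1 h1 m1 q1 p2 h2 m2 q2 : nat,
    let I := union_input n p1 h1 m1 q1 p2 h2 m2 q2 in
    prog I (rep_output (operand I) n (union_p p1 p2) (union_h h1 h2)
              (union_m m1 m2) (union_q p1 p2 q1 q2)).

Definition run_union (R : realType) (alg : union_algorithm)
    (n p1 h1 m1 q1 p2 h2 m2 q2 : nat)
    (Z1 : cpz R n p1 h1 m1 q1) (Z2 : cpz R n p2 h2 m2 q2) :=
  run (input_val Z1 Z2) (alg n p1 h1 m1 q1 p2 h2 m2 q2).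

Definition represents (R : realType) (I : Type) (inp : I -> R) (res : seq R)
    (n p h m q : nat) (S : rep (operand I) (operand I) n p h m q)
    (Z : cpz R n p h m q) : Prop :=
  map_rep (oval inp res) (oval inp res) S =
  map_rep id (fun k : nat => k%:R) Z.

Definition computes_union_and_merges (R : realType) (alg : union_algorithm) :
    Prop :=
  forall (n p1 h1 m1 q1 p2 h2 m2 q2 : nat)
    (Z1 : cpz R n p1 h1 m1 q1) (Z2 : cpz R n p2 h2 m2 q2),
  regular Z1 -> regular Z2 ->
  let r := run_union alg Z1 Z2 in
  represents (input_val Z1 Z2) (results r) (out r).1 (cpz_union Z1 Z2) /\
  exists Z' : cpz R n (union_p p1 p2) (union_h h1 h2) (union_m m1 m2)
                (tag (out r).2),
    merged (cpz_union Z1 Z2) Z' /\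
    represents (input_val Z1 Z2) (results r) (tagged (out r).2) Z'.

(* Main.v *)
(** The first constraint of the union forces the two new factors s, t to satisfy
    s t = 1, so s = t = 1 or s = t = -1.  With X and Y the mean squares of the
    factors of the two sets, the second constraint then reads Y = 0 when s = 1
    and X (1 - Y / 2) = 0 when s = -1.  Hence the factors of one of the sets
    vanish, together with all its monomials by regularity, and s selects the
    center and the constraint offset of the other.

    As for the complexity, all columns of the constraint exponent matrix are
    known to be pairwise distinct up to the coincidences of a column of R1 or R2
    with a column 2 e_k, and of the last column with the first column of Rbar.
    So it suffices to compare the entries of R1 and R2 with 0, 1 and 2, instead
    of sorting the columns.  No addition is needed for merging: in each row of
    A, at most one of the merged columns has a nonzero entry. *)

Require Import Defs.
From HB Require Import structures.
From mathcomp Require Import all_boot all_order all_algebra.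
From mathcomp Require Import classical_sets reals exp.
From mathcomp Require Import ring lra zify.

Set Implicit Arguments.
Unset Strict Implicit.
Unset Printing Implicit Defensive.

Import Order.TTheory GRing.Theory Num.Theory.
Local Open Scope ring_scope.
Local Open Scope classical_set_scope.

(** * The union as a set *)

Section Monomials.
Variable R : realType.

Lemma monomial_col_mx p p' h (a : 'cV[R]_p) (a' : 'cV_p')
    (E : 'M_(p, h)) (E' : 'M_(p', h)) i :
  monomial (col_mx a a') (col_mx E E') i = monomial a E i * monomial a' E' i.
Proof.
rewrite /monomial big_split_ord /=.
by congr (_ * _); apply: eq_bigr => k _; rewrite ?col_mxEu ?col_mxEd.
Qed.

Lemma monomial_row_mxl p h h' (a : 'cV[R]_p) (E : 'M_(p, h))
    (E' : 'M_(p, h')) i :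
  monomial a (row_mx E E') (lshift h' i) = monomial a E i.
Proof. by apply: eq_bigr => k _; rewrite row_mxEl. Qed.

Lemma monomial_row_mxr p h h' (a : 'cV[R]_p) (E : 'M_(p, h))
    (E' : 'M_(p, h')) i :
  monomial a (row_mx E E') (rshift h i) = monomial a E' i.
Proof. by apply: eq_bigr => k _; rewrite row_mxEr. Qed.

Lemma monomial_lsubmx p h h' (a : 'cV[R]_p) (E : 'M_(p, h + h')) i :
  monomial a (lsubmx E) i = monomial a E (lshift h' i).
Proof. by apply: eq_bigr => k _; rewrite mxE. Qed.

Lemma monomial_rsubmx p h h' (a : 'cV[R]_p) (E : 'M_(p, h + h')) i :
  monomial a (rsubmx E) i = monomial a E (rshift h i).
Proof. by apply: eq_bigr => k _; rewrite mxE. Qed.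

Lemma monomial_mx0 p h (a : 'cV[R]_p) (i : 'I_h) : monomial a 0 i = 1.
Proof. by rewrite /monomial big1 // => k _; rewrite mxE. Qed.

Lemma monomial_const_mx1 h (a : 'cV[R]_1) (i : 'I_h) :
  monomial a (const_mx 1%N) i = a 0 0.
Proof. by rewrite /monomial big_ord1 mxE. Qed.

(** A nonzero column has a positive exponent somewhere, and that power of 0 kills the product. This
    is how regularity enters the equality of sets. *)
Lemma monomial0 p h (E : 'M_(p, h)) i :
  col i E != 0 -> monomial (0 : 'cV[R]_p) E i = 0.
Proof.
move=> /cV0Pn[k]; rewrite mxE => Eki0.
by rewrite /monomial (bigD1 k) //= mxE expr0n (negPf Eki0) mul0r.
Qed.

Lemma monomial_single p h (a : 'cV[R]_p) (E : 'M_(p, h)) i k d :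
  (forall l, E l i = if k == l then d else 0%N) -> monomial a E i = a k 0 ^+ d.
Proof.
move=> EE; rewrite /monomial (bigD1 k) //= EE eqxx big1 ?mulr1 // => l lk.
by rewrite EE eq_sym (negPf lk).
Qed.

(** Common shape of the generator part of a point and of the left side of its constraints, so the
    same block lemmas serve both. *)
Definition mono_sum n p h (a : 'cV[R]_p) (G : 'M[R]_(n, h)) (E : 'M_(p, h)) :=
  \sum_(i < h) monomial a E i *: col i G.

Lemma mono_sum_split n p h h' (a : 'cV[R]_p) (G : 'M[R]_(n, h))
    (G' : 'M_(n, h')) (E : 'M_(p, h + h')) :
  mono_sum a (row_mx G G') E =
  mono_sum a G (lsubmx E) + mono_sum a G' (rsubmx E).
Proof.
rewrite /mono_sum big_split_ord /=.
congr (_ + _); apply: eq_bigr => i _.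
  by rewrite colKl monomial_lsubmx.
by rewrite colKr monomial_rsubmx.
Qed.

Lemma mono_sum_col_mx n n' p h (a : 'cV[R]_p) (G : 'M[R]_(n, h))
    (G' : 'M_(n', h)) (E : 'M_(p, h)) :
  mono_sum a (col_mx G G') E = col_mx (mono_sum a G E) (mono_sum a G' E).
Proof.
apply/colP => k; rewrite summxE; case: (split_ordP k) => l ->.
  rewrite col_mxEu summxE; apply: eq_bigr => i _; rewrite [LHS]mxE [RHS]mxE.
  by congr (_ * _); rewrite [LHS]mxE [RHS]mxE col_mxEu.
rewrite col_mxEd summxE; apply: eq_bigr => i _; rewrite [LHS]mxE [RHS]mxE.
by congr (_ * _); rewrite [LHS]mxE [RHS]mxE col_mxEd.
Qed.

Lemma mono_sum_mx0 n p h (a : 'cV[R]_p) (E : 'M_(p, h)) :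
  mono_sum a (0 : 'M_(n, h)) E = 0.
Proof. by rewrite /mono_sum big1 // => i _; rewrite col0 scaler0. Qed.

Lemma mono_sum0 n p h (G : 'M[R]_(n, h)) (E : 'M_(p, h)) :
  (forall i, col i E != 0) -> mono_sum 0 G E = 0.
Proof. by move=> E0; rewrite /mono_sum big1 // => i _; rewrite monomial0 ?scale0r. Qed.

Lemma eq_mono_sum n p p' h (a : 'cV[R]_p) (a' : 'cV_p') (G : 'M[R]_(n, h)) E E' :
  (forall i, monomial a E i = monomial a' E' i) ->
  mono_sum a G E = mono_sum a' G E'.
Proof. by move=> aE; apply: eq_bigr => i _; rewrite aE. Qed.

Lemma mono_sum_const p h (a : 'cV[R]_p) (E : 'M_(p, h)) (u : R) :
  mono_sum a (const_mx u) E = (u * \sum_i monomial a E i)%:M :> 'cV_1.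
Proof.
rewrite mulr_sumr; apply/colP => k; rewrite ord1 summxE mxE mulr1n.
by apply: eq_bigr => i _; rewrite !mxE mulrC.
Qed.

Lemma mono_sum_col1 n p (a : 'cV[R]_p) (v : 'cV[R]_n) (E : 'M_(p, 1)) :
  mono_sum a v E = monomial a E 0 *: v.
Proof. by rewrite /mono_sum big_ord1; congr (_ *: _); apply/colP => k; rewrite mxE. Qed.

Definition monoE := (monomial_lsubmx, monomial_rsubmx, monomial_col_mx,
  monomial_row_mxl, monomial_row_mxr, monomial_mx0, monomial_const_mx1,
  mul1r, mulr1).

Lemma monomial_scalar p (a : 'cV[R]_p) d i :
  monomial a (d%:M : 'M[nat]_p) i = a i 0 ^+ d.
Proof.
by apply: monomial_single => l; rewrite mxE eq_sym; case: (i == l).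
Qed.

(** Euclidean division by [p2] identifies the indices below [p1 * p2] with pairs. [F] takes naturals
    to avoid carrying bounds on quotients and remainders. *)
Lemma sum_divn_modn p1 p2 (F : nat -> nat -> R) :
  \sum_(j < p1 * p2) F (j %/ p2)%N (j %% p2)%N =
  \sum_(i < p1) \sum_(k < p2) F i k.
Proof.
case: p2 => [|p2].
  by rewrite muln0 big_ord0 big1 // => i _; rewrite big_ord0.
rewrite -(big_mkord xpredT (fun j => F (j %/ p2.+1)%N (j %% p2.+1)%N)).
rewrite big_nat_mul; rewrite big_mkord; apply: eq_bigr => i _.
(* Shift the inner range so that it starts at 0. *)
rewrite mulSn addnC -{1}[(i * _)%N]addn0 addnC big_addn addnC addnK big_mkord.
apply: eq_bigr => k _.
by rewrite addnC divnMDl // divn_small // addn0 modnMDl modn_small.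
Qed.

Definition sqsum p (x : 'cV[R]_p) := \sum_k x k 0 ^+ 2.

(** Column [j] yields the product of the squares of one entry of [x] and one of [y], and each pair
    of entries occurs exactly once; hence the sum factors. *)
Lemma sum_monomial_Hmx p1 p2 (x : 'cV[R]_p1) (y : 'cV[R]_p2) :
  \sum_i monomial (col_mx x y) (Hmx p1 p2) i = sqsum x * sqsum y.
Proof.
(* Extend the vectors by 0 to all natural indices, the form that [sum_divn_modn] expects. *)
pose v p (z : 'cV[R]_p) k := if insub k is Some i then z i 0 else 0.
have vE p (z : 'cV[R]_p) (i : 'I_p) k : val i = k -> z i 0 = v p z k.
  by move=> <-; rewrite /v valK.
transitivity (\sum_(j < p1 * p2) v _ x (j %/ p2)%N ^+ 2 * v _ y (j %% p2)%N ^+ 2).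
  apply: eq_bigr => j _; rewrite monomial_col_mx.
  have p2gt0 : (0 < p2)%N by case: (p2) j => // -[j]; rewrite muln0.
  have lt1 : (j %/ p2 < p1)%N by rewrite ltn_divLR.
  have lt2 : (j %% p2 < p2)%N by rewrite ltn_mod.
  rewrite (@monomial_single _ _ _ _ _ (Ordinal lt1) 2) => [|l]; last first.
    by rewrite mxE.
  rewrite (@monomial_single _ _ _ _ _ (Ordinal lt2) 2) => [|l]; last first.
    by rewrite mxE.
  by rewrite (vE _ x (Ordinal lt1) _ erefl) (vE _ y (Ordinal lt2) _ erefl).
rewrite (sum_divn_modn p1 p2 (fun i k => v _ x i ^+ 2 * v _ y k ^+ 2)).
rewrite mulr_suml; apply: eq_bigr => i _; rewrite mulr_sumr.
by apply: eq_bigr => k _; rewrite -(vE _ x i _ erefl) -(vE _ y k _ erefl).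
Qed.

(** * The constraints of the union, block by block *)

Definition union_point p1 p2 (s t : R) (x : 'cV[R]_p1) (y : 'cV[R]_p2) :
    'cV[R]_(union_p p1 p2) :=
  col_mx (const_mx s : 'cV_1) (col_mx (const_mx t : 'cV_1) (col_mx x y)).

Lemma union_pointP p1 p2 (a : 'cV[R]_(union_p p1 p2)) :
  exists s t x y, a = union_point s t x y.
Proof.
exists (usubmx a 0 0), (usubmx (dsubmx a) 0 0).
exists (usubmx (dsubmx (dsubmx a))), (dsubmx (dsubmx (dsubmx a))).
have mx11 (u : 'cV[R]_1) : const_mx (u 0 0) = u.
  by apply/colP => i; rewrite ord1 mxE.
by rewrite /union_point !mx11 !vsubmxK.
Qed.

Lemma mono_sum_union_E n p1 p2 h1 h2 s t (x : 'cV[R]_p1) (y : 'cV[R]_p2)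
    (g : 'cV_n) (G1 : 'M_(n, h1)) (G2 : 'M_(n, h2)) E1 E2 :
  mono_sum (union_point s t x y) (row_mx g (row_mx G1 G2)) (union_E E1 E2) =
  s *: g + (mono_sum x G1 E1 + mono_sum y G2 E2).
Proof.
rewrite !mono_sum_split mono_sum_col1 /union_E /union_point !monoE mxE.
by congr (_ + (_ + _)); apply: eq_mono_sum => i; rewrite !monoE.
Qed.

Lemma sum_monomial_s p1 p2 h s t (x : 'cV[R]_p1) (y : 'cV[R]_p2)
    (E : 'M_(p1 + p2, h)) :
  \sum_i monomial (union_point s t x y) (col_mx (const_mx 1%N) (col_mx 0 E)) i
  = s * \sum_i monomial (col_mx x y) E i.
Proof.
by rewrite mulr_sumr; apply: eq_bigr => i _; rewrite /union_point !monoE mxE.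
Qed.

Lemma sum_monomial_1 p1 p2 h s t (x : 'cV[R]_p1) (y : 'cV[R]_p2)
    (E : 'M_(p1 + p2, h)) :
  \sum_i monomial (union_point s t x y) (col_mx 0 (col_mx 0 E)) i
  = \sum_i monomial (col_mx x y) E i.
Proof. by apply: eq_bigr => i _; rewrite /union_point !monoE. Qed.

Lemma sum_monomial_x p1 p2 (x : 'cV[R]_p1) (y : 'cV[R]_p2) :
  \sum_i monomial (col_mx x y) (col_mx 2%:M 0) i = sqsum x.
Proof. by apply: eq_bigr => i _; rewrite !monoE monomial_scalar. Qed.

Lemma sum_monomial_y p1 p2 (x : 'cV[R]_p1) (y : 'cV[R]_p2) :
  \sum_i monomial (col_mx x y) (col_mx 0 2%:M) i = sqsum y.
Proof. by apply: eq_bigr => i _; rewrite !monoE monomial_scalar. Qed.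

(** Left side of the second constraint. Blocks of [Rbar] come in pairs with the same monomials up to
    a factor [s], whence the factors [1 - s] and [1 + s]. *)
Definition bar_value p1 p2 s t (x : 'cV[R]_p1) (y : 'cV[R]_p2) : R :=
  s - t + (1 - s) * (sqsum x / (2 * p1%:R))
  - (1 + s) * (sqsum y / (2 * p2%:R))
  - (1 - s) * (sqsum x * sqsum y / (4 * p1%:R * p2%:R)).

Lemma mono_sum_Rbar p1 p2 s t (x : 'cV[R]_p1) (y : 'cV[R]_p2) :
  mono_sum (union_point s t x y) (Abar R p1 p2) (Rbar p1 p2) =
  const_mx (bar_value s t x y).
Proof.
rewrite /Abar /Rbar !mono_sum_split !(row_mxKl, row_mxKr) !mono_sum_const.
rewrite !(big_ord1, sum_monomial_s, sum_monomial_1, sum_monomial_x, sum_monomial_y,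
  sum_monomial_Hmx, monoE).
apply/colP => k; rewrite ord1 !mxE !mulr1n /bar_value.
(* The inverses become atoms for [ring], so the identity also covers [p1] or [p2] equal to 0. *)
set u := (2 * p1%:R)^-1; set v := (2 * p2%:R)^-1; set w := (4 * _ * _)^-1.
ring.
Qed.

Lemma mono_sum_union_R p1 p2 m1 m2 q1 q2 s t (x : 'cV[R]_p1) (y : 'cV[R]_p2)
    (A1 : 'M_(m1, q1)) b1 R1 (A2 : 'M_(m2, q2)) b2 R2 :
  mono_sum (union_point s t x y) (union_A p1 p2 A1 b1 A2 b2) (union_R R1 R2) =
  col_mx (const_mx (s * t)) (col_mx (const_mx (bar_value s t x y))
    (col_mx (mono_sum x A1 R1 - (s / 2) *: b1)
            (mono_sum y A2 R2 + (s / 2) *: b2))).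
Proof.
rewrite /union_A /union_R.
(* [Abar] and [Rbar] are made opaque, lest the block rewriting split them too. *)
move: (mono_sum_Rbar s t x y); move: (Abar R p1 p2) (Rbar p1 p2) => Ab Rb RbE.
rewrite !mono_sum_col_mx !mono_sum_split !(row_mxKl, row_mxKr).
rewrite !(mono_sum_mx0, add0r, addr0) RbE !mono_sum_col1.
rewrite /Rhat /union_point !monoE !mxE.
congr (col_mx _ (col_mx _ (col_mx _ _))).
- by apply/colP => i; rewrite !mxE mulr1.
- congr (_ + _); last by rewrite -scaleNr scalerA; congr (_ *: _); ring.
  by apply: eq_mono_sum => i; rewrite !monoE.
- congr (_ + _); last by rewrite scalerA; congr (_ *: _); ring.
  by apply: eq_mono_sum => i; rewrite !monoE.
Qed.

(** * Vanishing factors from the second constraint *)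

Lemma sqsum0 p : sqsum (0 : 'cV[R]_p) = 0.
Proof. by rewrite /sqsum big1 // => k _; rewrite mxE expr0n. Qed.

Lemma sqsum_eq0 p (x : 'cV[R]_p) : sqsum x / (2 * p%:R) = 0 -> x = 0.
Proof.
(* For [p = 0] the quotient says nothing, being 0 by convention, but the only vector is 0. *)
case: p x => [|p] x; first by move=> _; apply/colP => -[].
move/eqP; rewrite mulf_eq0 invr_eq0 mulf_eq0 !pnatr_eq0 !orbF => /eqP/psumr_eq0P x0.
apply/colP => i; rewrite mxE; apply/eqP; rewrite -sqrf_eq0; apply/eqP.
by apply: x0 => // k _; exact: sqr_ge0.
Qed.

Lemma sqsum_le p (x : 'cV[R]_p) :
  (forall k, -1 <= x k 0 <= 1) -> sqsum x / (2 * p%:R) <= 1 / 2.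
Proof.
move=> x1; have [->|p0] := eqVneq p%:R (0 : R).
  by rewrite mulr0 invr0 mulr0; lra.
have p_gt0 : 0 < p%:R :> R by rewrite lt_def p0 ler0n.
rewrite ler_pdivrMr ?mulr_gt0 //.
suff : sqsum x <= p%:R by lra.
rewrite -[in leRHS](card_ord p) -sum1_card natr_sum.
apply: ler_sum => k _; have := x1 k; nra.
Qed.

(** At [s = t = 1] only the term in [sqsum y] survives, with factor -2. *)
Lemma bar1 p1 p2 (x : 'cV[R]_p1) (y : 'cV[R]_p2) : bar_value 1 1 x y = 0 -> y = 0.
Proof.
by move=> bar0; apply: sqsum_eq0; move: bar0; rewrite /bar_value; lra.
Qed.

(** With u and v the quotients of [sqsum x] and [sqsum y], the constraint reads 2 u (1 - v) = 0.
    Since v <= 1/2 on the box, u must vanish. *)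
Lemma barN1 p1 p2 (x : 'cV[R]_p1) (y : 'cV[R]_p2) :
  (forall k, -1 <= y k 0 <= 1) -> bar_value (- 1) (- 1) x y = 0 -> x = 0.
Proof.
move=> /sqsum_le y1 bar0; apply: sqsum_eq0.
have Exy : sqsum x * sqsum y / (4 * p1%:R * p2%:R) =
    sqsum x / (2 * p1%:R) * (sqsum y / (2 * p2%:R)).
  rewrite mulrACA -invfM; congr (_ * _^-1); ring.
move: bar0; rewrite /bar_value Exy; nra.
Qed.

(** A product of two numbers of absolute value at most 1 reaches 1 only if both have absolute value
    1 and the same sign. *)
Lemma sign_of_mul1 (s t : R) :
  -1 <= s <= 1 -> -1 <= t <= 1 -> s * t = 1 -> s = 1 /\ t = 1 \/ s = -1 /\ t = -1.
Proof.
move=> /andP[s1 s2] /andP[t1 t2] st.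
have [s0|s0] := leP 0 s; [left|right]; nra.
Qed.

Lemma cpz_union_setE n p1 h1 m1 q1 p2 h2 m2 q2
    (Z1 : cpz R n p1 h1 m1 q1) (Z2 : cpz R n p2 h2 m2 q2) :
  regular Z1 -> regular Z2 ->
  cpz_set Z1 `|` cpz_set Z2 = cpz_set (cpz_union Z1 Z2).
Proof.
case: Z1 Z2 => c1 G1 E1 A1 b1 R1 [c2 G2 E2 A2 b2 R2].
move=> [/= [_ E1n0] [_ R1n0]] [/= [_ E2n0] [_ R2n0]].
have barE1 (x : 'cV[R]_p1) : bar_value 1 1 x (0 : 'cV_p2) = 0.
  by rewrite /bar_value sqsum0; lra.
have barEN1 (y : 'cV[R]_p2) : bar_value (-1) (-1) (0 : 'cV_p1) y = 0.
  by rewrite /bar_value sqsum0; lra.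
(* The sign [s] turns half the sum of the centers plus [s] times half their difference into one of
   the two centers. *)
have halfD (u v w : 'cV[R]_n) : (1 / 2) *: (u + v) + ((1 / 2) *: (u - v) + w) = u + w.
  apply/colP => k; rewrite !mxE; lra.
have halfB (u v w : 'cV[R]_n) :
    (1 / 2) *: (u + v) + ((-1) *: ((1 / 2) *: (u - v)) + w) = v + w.
  apply/colP => k; rewrite !mxE; lra.
have box (s : R) (x : 'cV[R]_p1) (y : 'cV[R]_p2) :
    -1 <= s <= 1 -> (forall k, -1 <= x k 0 <= 1) ->
    (forall k, -1 <= y k 0 <= 1) ->
    forall k, -1 <= union_point s s x y k 0 <= 1.
  move=> s1 x1 y1 k; rewrite /union_point.
  case: (split_ordP k) => i ->; [by rewrite col_mxEu mxE | rewrite col_mxEd].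
  case: (split_ordP i) => j ->; [by rewrite col_mxEu mxE | rewrite col_mxEd].
  by case: (split_ordP j) => l ->; rewrite ?col_mxEu ?col_mxEd.
have box0 p : forall k, -1 <= (0 : 'cV[R]_p) k 0 <= 1 by move=> k; rewrite mxE; lra.
have box1 : (-1 : R) <= (1 : R) <= 1 by lra.
have boxN1 : (-1 : R) <= (-1 : R) <= 1 by lra.
(* In the selected set, half of the offset stays on each side of the constraint; together they
   restore the original one. *)
have half2 m (u v : 'cV[R]_m) : u - (1 / 2) *: v = (1 / 2) *: v <-> u = v.
  split=> [/colP uv|->]; apply/colP => k; last by rewrite !mxE; lra.
  by have := uv k; rewrite !mxE; lra.
apply/seteqP; split => z.
- case=> [[x [xR x1]] <-|[y [yR y1]] <-].
  + rewrite /= -!/(mono_sum _ _ _) in xR *.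
    (* The factors of the second set are put at 0: its constraint rows then reduce to an equality of
       half offsets. *)
    exists (union_point 1 1 x 0); rewrite /= -!/(mono_sum _ _ _); last first.
      by rewrite mono_sum_union_E scale1r (mono_sum0 _ E2n0) addr0 halfD.
    split; last exact: box.
    rewrite mono_sum_union_R barE1 xR (mono_sum0 _ R2n0) add0r mulr1.
    by congr (col_mx _ (col_mx _ (col_mx _ _))); apply/half2.
  + rewrite /= -!/(mono_sum _ _ _) in yR *.
    exists (union_point (-1) (-1) 0 y); rewrite /= -!/(mono_sum _ _ _); last first.
      by rewrite mono_sum_union_E (mono_sum0 _ E1n0) add0r halfB.
    split; last exact: box.
    rewrite mono_sum_union_R barEN1 yR (mono_sum0 _ R1n0) mulrNN mulr1.
    congr (col_mx _ (col_mx _ (col_mx _ _))).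
      by rewrite mulNr scaleNr opprK add0r.
    by rewrite mulNr scaleNr; apply/half2.
- case=> a [aR a1] <- /=; rewrite -!/(mono_sum _ _ _) in aR *.
  have [s [t [x [y aE]]]] := union_pointP a; subst a.
  have s1 : -1 <= s <= 1 by have := a1 (lshift _ 0); rewrite col_mxEu mxE.
  have t1 : -1 <= t <= 1.
    by have := a1 (rshift _ (lshift _ 0)); rewrite col_mxEd col_mxEu mxE.
  have x1 k : -1 <= x k 0 <= 1.
    by have := a1 (rshift _ (rshift _ (lshift _ k))); rewrite !col_mxEd col_mxEu.
  have y1 k : -1 <= y k 0 <= 1.
    by have := a1 (rshift _ (rshift _ (rshift _ k))); rewrite !col_mxEd.
  move: aR; rewrite /= mono_sum_union_R mono_sum_union_E.
  (* The first two rows give [s * t = 1] and the vanishing of [bar_value]; the last two are the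
     constraints of the two sets. *)
  move=> /eq_col_mx[/matrixP/(_ 0 0) st /eq_col_mx[/matrixP/(_ 0 0) b0]].
  move=> /eq_col_mx[aR1 aR2]; rewrite !mxE in st b0.
  have [[es et]|[es et]] := sign_of_mul1 s1 t1 st; subst s t.
  + left; exists x; rewrite /= -!/(mono_sum _ _ _).
      by split=> //; apply/half2.
    by rewrite (bar1 b0) (mono_sum0 _ E2n0) scale1r addr0 halfD.
  + right; exists y; rewrite /= -!/(mono_sum _ _ _).
      by split=> //; apply/half2; move: aR2; rewrite mulNr scaleNr.
    by rewrite (barN1 y1 b0) (mono_sum0 _ E1n0) add0r halfB.
Qed.

End Monomials.

(** * Columns of the constraint exponent matrix *)

Section Columns.

Definition colinj p q (M : 'M[nat]_(p, q)) := injective (fun i => col i M).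

Lemma col_entry (T : Type) p q (M : 'M[T]_(p, q)) i k : col i M k 0 = M k i.
Proof. exact: mxE. Qed.

Lemma colinj_col1 p (M : 'M_(p, 1)) : colinj M.
Proof. by move=> i j _; rewrite !ord1. Qed.

Lemma colinj_col_mxu p p' q (A : 'M_(p, q)) (B : 'M_(p', q)) :
  colinj A -> colinj (col_mx A B).
Proof. by move=> Ainj i j /=; rewrite !col_col_mx => /eq_col_mx[/Ainj]. Qed.

Lemma colinj_col_mxd p p' q (A : 'M_(p, q)) (B : 'M_(p', q)) :
  colinj B -> colinj (col_mx A B).
Proof. by move=> Binj i j /=; rewrite !col_col_mx => /eq_col_mx[_ /Binj]. Qed.

Lemma colinj_scalar p d : (0 < d)%N -> colinj (d%:M : 'M[nat]_p).
Proof.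
move=> d0 i j /colP/(_ i); rewrite !mxE eqxx.
by case: (eqVneq i j) => // _ d0'; rewrite -[d]/(d *+ 1) d0' in d0.
Qed.

(** The rows holding a 2 in a column are the quotient and the remainder of its index by [p2], which
    determine the index. *)
Lemma colinj_Hmx p1 p2 : colinj (Hmx p1 p2).
Proof.
move=> i j /colP ij; apply/val_inj => /=.
have p2gt0 : (0 < p2)%N by case: (p2) i {j ij} => // -[i]; rewrite muln0.
have lt1 : (i %/ p2 < p1)%N by rewrite ltn_divLR.
have lt2 : (i %% p2 < p2)%N by rewrite ltn_mod.
have := ij (lshift _ (Ordinal lt1)); have := ij (rshift _ (Ordinal lt2)).
rewrite ![col _ _ _ _]mxE !col_mxEu !col_mxEd !mxE /= !eqxx.
case: eqP => // e1 _; case: eqP => // e2 _.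
by rewrite (divn_eq i p2) (divn_eq j p2) e1 e2.
Qed.

(** An invariant that is constant on each block of [Rbar] and separates the blocks: the two first
    entries, then the sums of the two remaining parts. *)
Definition colkey p1 p2 (v : 'cV[nat]_(union_p p1 p2)) : nat * nat * nat * nat :=
  let w := dsubmx (dsubmx v) in
  (usubmx v 0 0, usubmx (dsubmx v) 0 0,
   (\sum_k usubmx w k ord0)%N, (\sum_k dsubmx w k ord0)%N).

Definition keyed_cols p1 p2 q (M : 'M_(union_p p1 p2, q))
    (ks : seq (nat * nat * nat * nat)) :=
  colinj M /\ forall i, colkey (col i M) \in ks.

(** Columns with different keys differ, so a block with a fresh key can be prepended without
    creating a coincidence. *)
Lemma keyed_row_mx p1 p2 q q' (A : 'M_(union_p p1 p2, q))
    (B : 'M_(union_p p1 p2, q')) k ks :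
  keyed_cols A [:: k] -> keyed_cols B ks -> k \notin ks ->
  keyed_cols (row_mx A B) (k :: ks).
Proof.
move=> [Ainj Ak] [Binj Bks] kks.
have AB i j : col i A <> col j B.
  by move=> e; move: kks (Bks j); rewrite -e; move: (Ak i);
    rewrite inE => /eqP -> /negP.
split=> [i j|i].
  case: (split_ordP i) => l ->; case: (split_ordP j) => l' -> /=;
    rewrite ?(colKl, colKr).
  - by move=> /Ainj ->.
  - by move=> /AB.
  - by move=> /esym/AB.
  - by move=> /Binj ->.
case: (split_ordP i) => l ->; rewrite inE ?(colKl, colKr).
  by have := Ak l; rewrite inE => ->.
by rewrite Bks orbT.
Qed.

Lemma keyed_block p1 p2 q a b (M : 'M_(p1 + p2, q)) s1 s2 :
  colinj M -> (forall j, \sum_k M (lshift _ k) j = s1)%N ->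
  (forall j, \sum_k M (rshift _ k) j = s2)%N ->
  @keyed_cols p1 p2 q (col_mx (const_mx a) (col_mx (const_mx b) M))
    [:: (a, b, s1, s2)].
Proof.
move=> Minj M1 M2; split; first exact/colinj_col_mxd/colinj_col_mxd.
move=> j; rewrite !col_col_mx inE /colkey col_mxKu !col_mxKd col_mxKu !mxE.
rewrite -(M1 j) -(M2 j); apply/eqP; congr (_, _, _).
  by apply: eq_bigr => k _; rewrite !mxE.
by apply: eq_bigr => k _; rewrite !mxE.
Qed.

Lemma sum_scalar_col p d (j : 'I_p) : (\sum_k (d%:M : 'M[nat]_p) k j = d)%N.
Proof.
rewrite (bigD1 j) //= mxE eqxx big1 ?addn0 // => k kj.
by rewrite mxE (negPf kj).
Qed.

Lemma colinj_Rbar p1 p2 : colinj (Rbar p1 p2).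
Proof.
have sum0 p q (j : 'I_q) : (\sum_k (0%R : 'M[nat]_(p, q)) k j = 0)%N.
  by rewrite big1 // => k _; rewrite mxE.
have Hu (j : 'I_(p1 * p2)) : (\sum_k Hmx p1 p2 (lshift _ k) j = 2)%N.
  have p2gt0 : (0 < p2)%N by case: (p2) j => // -[j]; rewrite muln0.
  have lt1 : (j %/ p2 < p1)%N by rewrite ltn_divLR.
  rewrite (bigD1 (Ordinal lt1)) //= col_mxEu mxE eqxx big1 ?addn0 // => k.
  by rewrite -val_eqE /= col_mxEu mxE eq_sym => /negPf ->.
have Hd (j : 'I_(p1 * p2)) : (\sum_k Hmx p1 p2 (rshift _ k) j = 2)%N.
  have p2gt0 : (0 < p2)%N by case: (p2) j => // -[j]; rewrite muln0.
  have lt2 : (j %% p2 < p2)%N by rewrite ltn_mod.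
  rewrite (bigD1 (Ordinal lt2)) //= col_mxEd mxE eqxx big1 ?addn0 // => k.
  by rewrite -val_eqE /= col_mxEd mxE eq_sym => /negPf ->.
have blk1 a b : @keyed_cols p1 p2 1 (col_mx (const_mx a) (col_mx (const_mx b) 0))
    [:: (a, b, 0, 0)%N].
  by apply: keyed_block; first exact: colinj_col1;
    move=> j; rewrite big1 // => k _; rewrite mxE.
have blkx a : @keyed_cols p1 p2 p1
    (col_mx (const_mx a) (col_mx (const_mx 0%N) (col_mx 2%:M 0)))
    [:: (a, 0, 2, 0)%N].
  apply: keyed_block; first exact/colinj_col_mxu/colinj_scalar.
    move=> j; rewrite -[RHS](@sum_scalar_col p1 2 j).
    by apply: eq_bigr => k _; rewrite col_mxEu.
  by move=> j; rewrite -[RHS](sum0 p2 p1 j); apply: eq_bigr => k _; rewrite col_mxEd.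
have blky a : @keyed_cols p1 p2 p2
    (col_mx (const_mx a) (col_mx (const_mx 0%N) (col_mx 0 2%:M)))
    [:: (a, 0, 0, 2)%N].
  apply: keyed_block; first exact/colinj_col_mxd/colinj_scalar.
    by move=> j; rewrite -[RHS](sum0 p1 p2 j); apply: eq_bigr => k _; rewrite col_mxEu.
  move=> j; rewrite -[RHS](@sum_scalar_col p2 2 j).
  by apply: eq_bigr => k _; rewrite col_mxEd.
have blkH a : @keyed_cols p1 p2 (p1 * p2)
    (col_mx (const_mx a) (col_mx (const_mx 0%N) (Hmx p1 p2)))
    [:: (a, 0, 2, 2)%N].
  by apply: keyed_block; first exact: colinj_Hmx.
(* The keys of the eight blocks in order; they are pairwise distinct. *)
suff [] : keyed_cols (Rbar p1 p2)
  [:: (1, 0, 0, 0); (0, 1, 0, 0); (0, 0, 2, 0); (1, 0, 2, 0);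
      (0, 0, 0, 2); (1, 0, 0, 2); (0, 0, 2, 2); (1, 0, 2, 2)]%N by [].
do 7?[apply: keyed_row_mx; last by []].
- exact: (blk1 1 0)%N.
- exact: (blk1 0 1)%N.
- exact: (blkx 0)%N.
- exact: (blkx 1)%N.
- exact: (blky 0)%N.
- exact: (blky 1)%N.
- exact: (blkH 0)%N.
- exact: (blkH 1)%N.
Qed.

(** * Coincidences between columns, and the tests that detect them *)

Definition le2 p q (M : 'M[nat]_(p, q)) := forall k i, (M k i <= 2)%N.

Lemma le2_row_mx p q q' (A : 'M_(p, q)) (B : 'M_(p, q')) :
  le2 A -> le2 B -> le2 (row_mx A B).
Proof.
by move=> A2 B2 k i; case: (split_ordP i) => j ->; rewrite ?row_mxEl ?row_mxEr.
Qed.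

Lemma le2_col_mx p p' q (A : 'M_(p, q)) (B : 'M_(p', q)) :
  le2 A -> le2 B -> le2 (col_mx A B).
Proof.
by move=> A2 B2 k i; case: (split_ordP k) => j ->; rewrite ?col_mxEu ?col_mxEd.
Qed.

Lemma le2_const p q d : (d <= 2)%N -> le2 (const_mx d : 'M_(p, q)).
Proof. by move=> d2 k i; rewrite mxE. Qed.

Lemma le2_Rbar p1 p2 : le2 (Rbar p1 p2).
Proof.
have le2_0 p q : le2 (0 : 'M_(p, q)) by move=> k i; rewrite mxE.
have le2_2 p : le2 (2%:M : 'M_p) by move=> k i; rewrite mxE; case: (_ == _).
have le2_H : le2 (Hmx p1 p2).
  by apply: le2_col_mx => k i; rewrite mxE; case: ifP.
by do ?[exact: le2_H | exact: le2_0 | exact: le2_2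
  | apply: le2_row_mx | apply: le2_col_mx | apply: le2_const].
Qed.

Lemma union_R_split p1 p2 q1 q2 (R1 : 'M_(p1, q1)) (R2 : 'M_(p2, q2)) i :
  [\/ forall k, (union_R R1 R2 k i <= 2)%N,
      exists j, i = rshift 1 (rshift (bar_q p1 p2) (lshift (q2 + 1) j)) /\
        col i (union_R R1 R2) = col_mx 0 (col_mx 0 (col_mx (col j R1) 0)) |
      exists j, i = rshift 1 (rshift (bar_q p1 p2) (rshift q1 (lshift 1 j))) /\
        col i (union_R R1 R2) = col_mx 0 (col_mx 0 (col_mx 0 (col j R2)))].
Proof.
rewrite /union_R; case: (split_ordP i) => a ->.
  constructor 1 => k; rewrite row_mxEl.
  by do 2?apply: le2_col_mx; apply: le2_const.
case: (split_ordP a) => c ->.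
  by constructor 1 => k; rewrite row_mxEr row_mxEl le2_Rbar.
case: (split_ordP c) => d ->.
  constructor 2; exists d; split=> //.
  by rewrite !(colKr, col_col_mx, colKl, col0).
case: (split_ordP d) => e ->.
  constructor 3; exists e; split=> //.
  by rewrite !(colKr, col_col_mx, colKl, col0).
constructor 1 => k; rewrite !row_mxEr.
case: (split_ordP k) => u ->; [by rewrite col_mxEu !row_mxEr mxE | rewrite col_mxEd].
case: (split_ordP u) => v ->; [by rewrite col_mxEu !row_mxEr mxE | rewrite col_mxEd].
by case: (split_ordP v) => w ->; rewrite ?col_mxEu ?col_mxEd !row_mxEr mxE.
Qed.

(** Columns from [R1] are distinct, as are those from [R2]. A column common to both would be zero,
    their supports being disjoint. Any other coincidence involves a column whose entries are at most
    2. *)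
Lemma union_R_eq_col p1 p2 q1 q2 (R1 : 'M_(p1, q1)) (R2 : 'M_(p2, q2)) i j :
  distinct_nonzero_cols R1 -> distinct_nonzero_cols R2 ->
  col i (union_R R1 R2) = col j (union_R R1 R2) ->
  i = j \/ forall k, (union_R R1 R2 k i <= 2)%N.
Proof.
move=> [R1inj R1n0] [R2inj R2n0] eij.
have [i2|[a [ia ca]]|[a [ia ca]]] := union_R_split R1 R2 i; first by right.
  have [j2|[b [jb cb]]|[b [jb cb]]] := union_R_split R1 R2 j.
  - by right=> k; rewrite -col_entry eij col_entry.
  - left; rewrite ia jb; move: eij; rewrite ca cb.
    by move=> /eq_col_mx[_ /eq_col_mx[_ /eq_col_mx[/R1inj -> _]]].
  - move: eij; rewrite ca cb => /eq_col_mx[_ /eq_col_mx[_ /eq_col_mx[e _]]].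
    by have := R1n0 a; rewrite e eqxx.
have [j2|[b [jb cb]]|[b [jb cb]]] := union_R_split R1 R2 j.
- by right=> k; rewrite -col_entry eij col_entry.
- move: eij; rewrite ca cb => /eq_col_mx[_ /eq_col_mx[_ /eq_col_mx[_ e]]].
  by have := R2n0 a; rewrite e eqxx.
- left; rewrite ia jb; move: eij; rewrite ca cb.
  by move=> /eq_col_mx[_ /eq_col_mx[_ /eq_col_mx[_ /R2inj ->]]].
Qed.

(** Indistinguishability under the tests of the algorithm, [t] being 0, 1 or 2. Entries above 2 may
    differ. *)
Definition agree2 p q (M N : 'M[nat]_(p, q)) :=
  forall k i (t : 'I_3), (M k i <= t)%N = (N k i <= t)%N.

Lemma agree2_sym p q (M N : 'M_(p, q)) : agree2 M N -> agree2 N M.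
Proof. by move=> MN k i t; rewrite MN. Qed.

Lemma agree2_row_mx p q q' (A C : 'M_(p, q)) (B D : 'M_(p, q')) :
  agree2 A C -> agree2 B D -> agree2 (row_mx A B) (row_mx C D).
Proof.
move=> AC BD k i t; case: (split_ordP i) => j ->.
  by rewrite !row_mxEl.
by rewrite !row_mxEr.
Qed.

Lemma agree2_col_mx p p' q (A C : 'M_(p, q)) (B D : 'M_(p', q)) :
  agree2 A C -> agree2 B D -> agree2 (col_mx A B) (col_mx C D).
Proof.
move=> AC BD k i t; case: (split_ordP k) => j ->.
  by rewrite !col_mxEu.
by rewrite !col_mxEd.
Qed.

Lemma agree2_union_R p1 p2 q1 q2 (R1 S1 : 'M_(p1, q1)) (R2 S2 : 'M_(p2, q2)) :
  agree2 R1 S1 -> agree2 R2 S2 -> agree2 (union_R R1 R2) (union_R S1 S2).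
Proof.
move=> RS1 RS2.
by do 2!(apply: agree2_row_mx => //); do 3?(apply: agree2_col_mx => //);
  do 2?(apply: agree2_row_mx => //).
Qed.

Lemma agree2_eq p q (M N : 'M_(p, q)) k i :
  agree2 M N -> (M k i <= 2)%N -> N k i = M k i.
Proof.
move=> MN; have := MN k i (@Ordinal 3 0 isT).
have := MN k i (@Ordinal 3 1 isT); have := MN k i (@Ordinal 3 2 isT) => /=.
lia.
Qed.

(* A column shared by two indices has entries at most 2, and such columns are
   determined by the comparisons of their entries with 0, 1 and 2. *)
Lemma agree2_eq_col p1 p2 q1 q2 (R1 S1 : 'M_(p1, q1)) (R2 S2 : 'M_(p2, q2)) i j :
  distinct_nonzero_cols R1 -> distinct_nonzero_cols R2 ->
  agree2 R1 S1 -> agree2 R2 S2 ->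
  col i (union_R R1 R2) = col j (union_R R1 R2) ->
  col i (union_R S1 S2) = col j (union_R S1 S2).
Proof.
move=> R1d R2d RS1 RS2 eij; have RS := agree2_union_R RS1 RS2.
have [->//|i2] := union_R_eq_col R1d R2d eij.
have eUk k : union_R R1 R2 k i = union_R R1 R2 k j.
  by rewrite -col_entry eij col_entry.
apply/colP => k; rewrite !col_entry (agree2_eq RS) //.
by rewrite (agree2_eq RS) -eUk.
Qed.

End Columns.

(** * Programs and merging *)

Section Programs.
Variables (R : realType) (I O : Type) (inp : I -> R).

Definition instr : Type := (arith_op * operand I * operand I)%type.

Definition instr_val (res : seq R) (i : instr) : R :=
  arith i.1.1 (oval inp res i.1.2) (oval inp res i.2).

Fixpoint arith_seq (s : seq instr) (t : prog I O) : prog I O :=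
  if s is (o, x, y) :: s' then Arith o x y (arith_seq s' t) else t.

(** Such an operand refers only to the first [n] results, so its value is stable when further
    results are appended. *)
Definition older n (x : operand I) : bool :=
  if x is Result k then (k < n)%N else true.

Definition older_instr n (i : instr) := older n i.1.2 && older n i.2.

Lemma oval_cat res ext x :
  older (size res) x -> oval inp (res ++ ext) x = oval inp res x.
Proof. by case: x => //= k kres; rewrite nth_cat kres. Qed.

Lemma exec_arith_seq s t res k : all (older_instr (size res)) s ->
  exec inp (arith_seq s t) res k =
  exec inp t (res ++ map (instr_val res) s) (k + size s)%N.
Proof.
(* Generalize over the results [ext] produced by the earlier instructions of the sequence, which the
   later ones do not see. *)
rewrite -[X in exec inp _ X]cats0 -[X in exec inp t (X ++ _)]cats0 -catA.
move: [::] => ext; elim: s ext k => [|[[o x] y] s IH] ext k /=.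
  by rewrite cats0 addn0.
move=> /andP[/andP[/= xo yo] so].
by rewrite !oval_cat // rcons_cat IH // cat_rcons addSnnS.
Qed.

Section Layer.
Variables (J : finType) (f : J -> instr).

(** A batch of mutually independent instructions. Indexing it by a finite type lets a result be
    addressed by its meaning, through [layer_res], instead of by its position. *)
Definition layer (t : prog I O) : prog I O := arith_seq (map f (enum J)) t.

Definition layer_vals res := res ++ map (instr_val res) (map f (enum J)).

Definition layer_res base (j : J) : operand I := Result I (base + enum_rank j).

Lemma exec_layer t res k : (forall j, older_instr (size res) (f j)) ->
  exec inp (layer t) res k = exec inp t (layer_vals res) (k + #|J|)%N.
Proof.
move=> fold; rewrite exec_arith_seq; first by rewrite size_map -cardE.
by rewrite all_map; apply/allP => j _; exact: fold.
Qed.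

Lemma oval_layer res j :
  oval inp (layer_vals res) (layer_res (size res) j) = instr_val res (f j).
Proof.
rewrite /= nth_cat ltnNge leq_addr /= addKn -map_comp.
rewrite (nth_map j) ?nth_enum_rank //.
by rewrite -cardE ltn_ord.
Qed.

Lemma size_layer_vals res : size (layer_vals res) = (size res + #|J|)%N.
Proof. by rewrite /layer_vals size_cat 2!size_map -cardE. Qed.

End Layer.

(** The continuation receives the list of answers; every branch performs all the tests, so the cost
    does not depend on the answers. *)
Fixpoint ask (s : seq (operand I * operand I)) (f : seq bool -> prog I O) :
    prog I O :=
  if s is (x, y) :: s' then
    IfLe x y (ask s' (fun bs => f (true :: bs)))
             (ask s' (fun bs => f (false :: bs)))
  else f [::].

Lemma exec_ask s f res k :
  exec inp (ask s f) res k =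
  exec inp (f [seq oval inp res x.1 <= oval inp res x.2 | x <- s]) res
    (k + size s)%N.
Proof.
elim: s f k => [|[x y] s IH] f k /=; first by rewrite addn0.
by case: ifP => _; rewrite IH addSnnS.
Qed.

End Programs.

(** * Merging along the classes of a labelling *)

Section Representatives.
Variables (q : nat) (T : eqType) (c : 'I_q -> T).

(** The choice made by [pick] depends only on the class of [i], so exactly one index of each class
    is fixed by it. *)
Definition reps : {set 'I_q} := [set i | [pick i' | c i' == c i] == Some i].

Definition rep_idx : 'I_#|reps| -> 'I_q := enum_val.

Lemma rep_idx_inj i j : c (rep_idx i) = c (rep_idx j) -> i = j.
Proof.
move=> cij; apply: enum_val_inj; apply: Some_inj.
have := enum_valP i; have := enum_valP j; rewrite !inE.
by rewrite -/(rep_idx i) -/(rep_idx j) cij => /eqP <- /eqP <-.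
Qed.

Lemma rep_idx_surj i : exists j, c (rep_idx j) = c i.
Proof.
have [i' ei' ci'] : exists2 i', [pick i' | c i' == c i] = Some i' & c i' = c i.
  by case: pickP => [i' /eqP|/(_ i)]; [exists i' | rewrite eqxx].
have ri' : i' \in reps by rewrite inE ci' ei'.
by exists (enum_rank_in ri' i'); rewrite /rep_idx enum_rankK_in.
Qed.

End Representatives.

Section Merging.
Variables (R : realType) (n p h m q : nat).

(** Classes are given by a labelling [c], since a leaf of the program sees not the columns but
    labels derived from the answers. *)
Definition merge_with (T : eqType) (c : 'I_q -> T) (Z : cpz R n p h m q) :
    cpz R n p h m #|reps c| :=
  Rep (center Z) (gens Z) (expo Z)
    (\matrix_(r, j) \sum_(i | c i == c (rep_idx j)) cgens Z r i)
    (coff Z) (colsub (@rep_idx q T c) (cexpo Z)).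

Lemma merged_merge_with (T : eqType) (c : 'I_q -> T) (Z : cpz R n p h m q) :
  (forall i j, col i (cexpo Z) = col j (cexpo Z) <-> c i = c j) ->
  merged Z (merge_with c Z).
Proof.
move=> cE; have colE j :
    col j (cexpo (merge_with c Z)) = col (rep_idx j) (cexpo Z).
  by apply/colP => k; rewrite !mxE.
split=> //.
- by move=> i j /=; rewrite !colE => /cE/rep_idx_inj.
- by move=> i; have [j cj] := rep_idx_surj c i; exists j; rewrite colE; apply/cE.
- by move=> j; exists (rep_idx j); rewrite colE.
- move=> j; apply/colP => r; rewrite summxE !mxE.
  apply: eq_big => [i|i _]; last by rewrite mxE.
  by rewrite colE; apply/eqP/eqP => /cE.
Qed.

Variables (I : Type) (inp : I -> R) (res : seq R).

(** Purely syntactic: an input whose value happens to be 0 is not recognized. *)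
Definition is_zero (x : operand I) := if x is Const 0 then true else false.

Lemma is_zeroP x : is_zero x -> oval inp res x = 0.
Proof. by case: x => // -[]. Qed.

(** A merged entry is the one entry of its class that is not the constant 0, if any. This replaces
    the sum without any arithmetic; its correctness rests on the uniqueness assumed in
    [represents_sym_merge]. *)
Definition sym_merge (T : eqType) (c : 'I_q -> T)
    (S : rep (operand I) (operand I) n p h m q) :
    {q' : nat & rep (operand I) (operand I) n p h m q'} :=
  Tagged _ (Rep (center S) (gens S) (expo S)
    (\matrix_(r, j)
      odflt (Const I 0) (omap (cgens S r)
        [pick i | (c i == c (rep_idx j)) && ~~ is_zero (cgens S r i)]))
    (coff S) (colsub (@rep_idx q T c) (cexpo S))).

Lemma represents_sym_merge (T : eqType) (c : 'I_q -> T)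
    (S : rep (operand I) (operand I) n p h m q) (Z : cpz R n p h m q) :
  (forall r i j, ~~ is_zero (cgens S r i) -> ~~ is_zero (cgens S r j) ->
     c i = c j -> i = j) ->
  represents inp res S Z ->
  represents inp res (tagged (sym_merge c S)) (merge_with c Z).
Proof.
rewrite /represents /map_rep /= => Suniq [-> -> -> SA -> SR]; congr Rep; last first.
  by apply/matrixP => k j; move/matrixP/(_ k (rep_idx j)): SR; rewrite !mxE.
apply/matrixP => r j; rewrite !mxE.
have {}SA i : oval inp res (cgens S r i) = cgens Z r i.
  by move/matrixP/(_ r i): SA; rewrite !mxE.
case: pickP => [i0 /andP[/eqP ci0 Si0]|S0] /=; last first.
  rewrite big1 // => i ci; rewrite -SA is_zeroP //.
  by have := S0 i; rewrite ci /= => /negbFE.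
rewrite (bigD1 i0) ?ci0 //= SA big1 ?addr0 // => i /andP[/eqP ci ii0].
rewrite -SA is_zeroP //; apply: contraNT ii0 => Si.
by apply/eqP; apply: Suniq Si Si0 _; rewrite ci0.
Qed.

End Merging.

(** * The algorithm *)

Section Algorithm.
Variables n p1 h1 m1 q1 p2 h2 m2 q2 : nat.

Notation X := (union_input n p1 h1 m1 q1 p2 h2 m2 q2).
Notation op := (operand X).

Definition in1 (e : entry n p1 h1 m1 q1) : op := Input (inl e).
Definition in2 (e : entry n p2 h2 m2 q2) : op := Input (inr e).
Definition cst (k : nat) : op := Const X k.

(** Operands of a layer must precede it, hence two layers: first the reciprocals, -1, the sums and
    differences of centers and the halved offsets; then the negations and halvings of these
    results. *)
Definition idx1 : finType := ('I_4 + ('I_n + 'I_n + ('I_m1 + 'I_m2)))%type.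

Definition ops1 (i : idx1) : instr X :=
  match i with
  | inl k => nth (Add, cst 0, cst 0)
      [:: (Div, cst 1, cst (2 * p1)); (Div, cst 1, cst (2 * p2));
          (Div, cst 1, cst (4 * p1 * p2)); (Defs.Sub, cst 0, cst 1)] k
  | inr (inl (inl i)) => (Add, in1 (Center _ _ _ _ i), in2 (Center _ _ _ _ i))
  | inr (inl (inr i)) => (Defs.Sub, in1 (Center _ _ _ _ i), in2 (Center _ _ _ _ i))
  | inr (inr (inl i)) => (Div, in1 (Coff _ _ _ _ i), cst 2)
  | inr (inr (inr i)) => (Div, in2 (Coff _ _ _ _ i), cst 2)
  end.

Definition res1 (i : idx1) : op := layer_res X 0 i.

Definition u1 := res1 (inl (@Ordinal 4 0 isT)).
Definition u2 := res1 (inl (@Ordinal 4 1 isT)).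
Definition u12 := res1 (inl (@Ordinal 4 2 isT)).
Definition minus1 := res1 (inl (@Ordinal 4 3 isT)).
Definition half_b1 i := res1 (inr (inr (inl i))).
Definition half_b2 i := res1 (inr (inr (inr i))).

Definition idx2 : finType := ('I_3 + ('I_n + 'I_n + 'I_m1))%type.

Definition ops2 (i : idx2) : instr X :=
  match i with
  | inl k => (Defs.Sub, cst 0, nth (cst 0) [:: u1; u2; u12] k)
  | inr (inl (inl i)) => (Div, res1 (inr (inl (inl i))), cst 2)
  | inr (inl (inr i)) => (Div, res1 (inr (inl (inr i))), cst 2)
  | inr (inr i) => (Defs.Sub, cst 0, half_b1 i)
  end.

Definition res2 (i : idx2) : op := layer_res X #|idx1| i.

Definition opp_u1 := res2 (inl (@Ordinal 3 0 isT)).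
Definition opp_u2 := res2 (inl (@Ordinal 3 1 isT)).
Definition opp_u12 := res2 (inl (@Ordinal 3 2 isT)).
Definition half_sum i := res2 (inr (inl (inl i))).
Definition half_diff i := res2 (inr (inl (inr i))).
Definition opp_half_b1 i := res2 (inr (inr i)).

Local Notation "A <|> B" := (row_mx A B) (at level 61, right associativity).
Local Notation "A </> B" := (col_mx A B) (at level 63, right associativity).
Local Notation z := (const_mx (cst 0)).

Definition sym_E : 'M[op]_(union_p p1 p2, union_h h1 h2) :=
      (const_mx (cst 1) <|> z <|> z)
  </> (z <|> z <|> z)
  </> (z <|> (\matrix_(k, j) in1 (Expo _ _ _ k j)) <|> z)
  </> (z <|> z <|> (\matrix_(k, j) in2 (Expo _ _ _ k j))).

Definition sym_Abar : 'rV[op]_(bar_q p1 p2) :=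
  const_mx (cst 1) <|> const_mx minus1
  <|> const_mx u1 <|> const_mx opp_u1
  <|> const_mx opp_u2 <|> const_mx opp_u2
  <|> const_mx opp_u12 <|> const_mx u12.

Definition sym_A : 'M[op]_(union_m m1 m2, union_q p1 p2 q1 q2) :=
      (const_mx (cst 1) <|> z        <|> z <|> z <|> z)
  </> (z                <|> sym_Abar <|> z <|> z <|> z)
  </> (z <|> z <|> (\matrix_(k, j) in1 (Cgens _ _ _ k j)) <|> z
         <|> \col_k opp_half_b1 k)
  </> (z <|> z <|> z <|> (\matrix_(k, j) in2 (Cgens _ _ _ k j))
         <|> \col_k half_b2 k).

Definition sym_R : 'M[op]_(union_p p1 p2, union_q p1 p2 q1 q2) :=
  map_mx cst (Rhat p1 p2) <|> map_mx cst (Rbar p1 p2) <|>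
    (    (z  <|> z  <|> const_mx (cst 1))
     </> (z  <|> z  <|> z)
     </> ((\matrix_(k, j) in1 (Cexpo _ _ _ k j)) <|> z <|> z)
     </> (z  <|> (\matrix_(k, j) in2 (Cexpo _ _ _ k j)) <|> z)).

Definition sym_union :
    rep op op n (union_p p1 p2) (union_h h1 h2) (union_m m1 m2)
      (union_q p1 p2 q1 q2) :=
  Rep (\col_i half_sum i)
    ((\col_i half_diff i) <|> (\matrix_(i, j) in1 (Gens _ _ _ i j))
       <|> (\matrix_(i, j) in2 (Gens _ _ _ i j)))
    sym_E sym_A
    (const_mx (cst 1) </> z </> (\col_k half_b1 k) </> (\col_k half_b2 k))
    sym_R.

Definition pos : finType := ('I_p1 * 'I_q1 + 'I_p2 * 'I_q2)%type.

Definition test_ops (x : pos * 'I_3) : op * op :=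
  (match x.1 with
   | inl kj => in1 (Cexpo _ _ _ kj.1 kj.2)
   | inr kj => in2 (Cexpo _ _ _ kj.1 kj.2)
   end, cst x.2).

(** The answers the program receives on exponents [R12], expressed on naturals and in the order of
    [test_ops]. *)
Definition tests (R12 : 'M[nat]_(p1, q1) * 'M[nat]_(p2, q2)) : seq bool :=
  [seq (match x.1 with
        | inl kj => R12.1 kj.1 kj.2
        | inr kj => R12.2 kj.1 kj.2
        end <= x.2)%N | x : pos * 'I_3 <- enum {: pos * 'I_3}].

Definition compatible (bs : seq bool)
    (R12 : 'M[nat]_(p1, q1) * 'M[nat]_(p2, q2)) : Prop :=
  [/\ distinct_nonzero_cols R12.1, distinct_nonzero_cols R12.2 & tests R12 = bs].

(* The answers to the tests do not determine the constraint exponents, only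
   which columns are identical: a leaf can use any exponents that are
   compatible with the answers it has seen. *)
Definition guess (bs : seq bool) : 'M[nat]_(p1, q1) * 'M[nat]_(p2, q2) :=
  xget (0, 0) (compatible bs).

Definition guess_col bs i := col i (union_R (guess bs).1 (guess bs).2).

Definition union_prog : prog X (rep_output op n (union_p p1 p2) (union_h h1 h2)
    (union_m m1 m2) (union_q p1 p2 q1 q2)) :=
  layer ops1 (layer ops2 (ask (map test_ops (enum {: pos * 'I_3}))
    (fun bs => Ret _ (sym_union, sym_merge (guess_col bs) sym_union)))).

Definition union_cost : nat := (#|idx1| + #|idx2| + #|{: pos * 'I_3}|)%N.

Lemma union_costE : union_cost =
  (7 + 4 * n + 2 * m1 + m2 + 3 * (p1 * q1 + p2 * q2))%N.
Proof.
rewrite /union_cost !(card_sum, card_prod, card_ord); lia.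
Qed.

Section Run.
Variables (R : realType).
Variables (Z1 : cpz R n p1 h1 m1 q1) (Z2 : cpz R n p2 h2 m2 q2).
Hypotheses (reg1 : regular Z1) (reg2 : regular Z2).

Notation inp := (input_val Z1 Z2).

Definition vals1 := layer_vals inp ops1 [::].
Definition vals2 := layer_vals inp ops2 vals1.

Definition answers : seq bool := tests (cexpo Z1, cexpo Z2).

Lemma older_res1 (i : idx1) k : (#|idx1| <= k)%N -> older k (res1 i).
Proof. by move=> Jk; rewrite /= add0n (leq_trans (ltn_ord _)). Qed.

Lemma size_vals1 : size vals1 = #|idx1|.
Proof. by rewrite size_layer_vals. Qed.

Lemma run_union_prog : run inp union_prog =
  Outcome (sym_union, sym_merge (guess_col answers) sym_union) vals2 union_cost.
Proof.
rewrite /run /union_prog exec_layer; last first.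
  by case=> [[[|[|[|[|]]]]]|[[|]|[|]]].
rewrite -/vals1 exec_layer; last first.
  rewrite size_vals1; case=> [[[|[|[|m]]] lt]|[[i|i]|i]] //;
  by apply/andP; split=> //; exact: (older_res1 _ (leqnn _)).
rewrite -/vals2 exec_ask /= add0n size_map -cardE -/union_cost.
suff -> : [seq oval inp vals2 x.1 <= oval inp vals2 x.2
          | x <- map test_ops (enum {: pos * 'I_3})] = answers by [].
rewrite -map_comp /answers /tests; apply: eq_map => -[[kj|kj] t] /=;
  by rewrite ler_nat.
Qed.

(** The actual exponents are compatible with their own answers, so [xget] does not return its
    default. *)
Lemma guess_answers : compatible answers (guess answers).
Proof.
apply: (@xgetPex _ _ (compatible answers)); exists (cexpo Z1, cexpo Z2).
by split=> //; [case: reg1 | case: reg2].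
Qed.

Lemma tests_inj R12 S12 : tests R12 = tests S12 ->
  agree2 R12.1 S12.1 /\ agree2 R12.2 S12.2.
Proof.
move=> /eq_in_map RS; split=> k j t.
  by apply: (RS (inl (k, j), t)); rewrite mem_enum.
by apply: (RS (inr (k, j), t)); rewrite mem_enum.
Qed.

(** Actual and guessed exponents agree on all tests and both have distinct nonzero columns, so
    [agree2_eq_col] applies in both directions. *)
Lemma guess_colE i j :
  col i (cexpo (cpz_union Z1 Z2)) = col j (cexpo (cpz_union Z1 Z2)) <->
  guess_col answers i = guess_col answers j.
Proof.
have [g1 g2 /tests_inj[/= a1 a2]] := guess_answers.
have [[_ r1] [_ r2]] := (reg1, reg2).
split; apply: agree2_eq_col => //; exact: agree2_sym.
Qed.

Lemma oval_res1 i : oval inp vals2 (res1 i) = instr_val inp [::] (ops1 i).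
Proof.
rewrite oval_cat; last by rewrite size_vals1 older_res1.
exact: (oval_layer _ _ [::]).
Qed.

Lemma oval_res2 i : oval inp vals2 (res2 i) = instr_val inp vals1 (ops2 i).
Proof. by rewrite /res2 -size_vals1 oval_layer. Qed.

Lemma oval_vals1 i : oval inp vals1 (res1 i) = instr_val inp [::] (ops1 i).
Proof. exact: (oval_layer _ _ [::]). Qed.

Lemma oval_consts :
  [/\ oval inp vals2 u1 = 1 / (2 * p1%:R), oval inp vals2 u2 = 1 / (2 * p2%:R),
      oval inp vals2 u12 = 1 / (4 * p1%:R * p2%:R) &
      oval inp vals2 minus1 = -1].
Proof.
by split; rewrite oval_res1 /instr_val /= ?natrM ?sub0r.
Qed.

Section Valuation.
(** An abstract valuation, known only through the values it needs, keeps the addresses of results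
    out of the block computations. *)
Variable v : op -> R.
Hypothesis v_cst : forall k, v (cst k) = k%:R.
Hypothesis v_in1 : forall e, v (in1 e) = entry_val Z1 e.
Hypothesis v_in2 : forall e, v (in2 e) = entry_val Z2 e.
Hypothesis v_u1 : v u1 = 1 / (2 * p1%:R).
Hypothesis v_u2 : v u2 = 1 / (2 * p2%:R).
Hypothesis v_u12 : v u12 = 1 / (4 * p1%:R * p2%:R).
Hypothesis v_minus1 : v minus1 = -1.
Hypothesis v_opp_u1 : v opp_u1 = - (1 / (2 * p1%:R)).
Hypothesis v_opp_u2 : v opp_u2 = - (1 / (2 * p2%:R)).
Hypothesis v_opp_u12 : v opp_u12 = - (1 / (4 * p1%:R * p2%:R)).
Hypothesis v_half_sum :
  forall i, v (half_sum i) = 1 / 2 * (center Z1 i 0 + center Z2 i 0).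
Hypothesis v_half_diff :
  forall i, v (half_diff i) = 1 / 2 * (center Z1 i 0 - center Z2 i 0).
Hypothesis v_half_b1 : forall i, v (half_b1 i) = 1 / 2 * coff Z1 i 0.
Hypothesis v_half_b2 : forall i, v (half_b2 i) = 1 / 2 * coff Z2 i 0.
Hypothesis v_opp_half_b1 :
  forall i, v (opp_half_b1 i) = - (1 / 2) * coff Z1 i 0.

Let natr := fun k : nat => k%:R : R.

Let map_z a b : map_mx v (z : 'M_(a, b)) = 0.
Proof. by rewrite map_const_mx v_cst. Qed.

Let map_one a b : map_mx v (const_mx (cst 1) : 'M_(a, b)) = const_mx 1.
Proof. by rewrite map_const_mx v_cst. Qed.

Let map_natr0 a b : map_mx natr (0 : 'M_(a, b)) = 0.
Proof. by rewrite -[0]/(const_mx 0%N) map_const_mx. Qed.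

Let map_natr1 a b : map_mx natr (const_mx 1%N : 'M_(a, b)) = const_mx 1.
Proof. by rewrite map_const_mx. Qed.

Let map_cst a b (M : 'M_(a, b)) : map_mx v (map_mx cst M) = map_mx natr M.
Proof. by apply/matrixP => i j; rewrite !mxE v_cst. Qed.

Let map_sym_E : map_mx v sym_E = map_mx natr (union_E (expo Z1) (expo Z2)).
Proof.
rewrite /sym_E /union_E !map_col_mx !map_row_mx !map_z !map_one !map_natr0 map_natr1.
congr (col_mx _ (col_mx _ (col_mx (row_mx _ (row_mx _ _)) (row_mx _ (row_mx _ _))))).
  by apply/matrixP => i j; rewrite !mxE v_in1.
by apply/matrixP => i j; rewrite !mxE v_in2.
Qed.

Let map_sym_Abar : map_mx v sym_Abar = Abar R p1 p2.
Proof.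
rewrite /sym_Abar /Abar !map_row_mx !map_const_mx v_cst.
by rewrite v_minus1 v_u1 v_u12 v_opp_u1 v_opp_u2 v_opp_u12.
Qed.

Let map_sym_A : map_mx v sym_A =
  union_A p1 p2 (cgens Z1) (coff Z1) (cgens Z2) (coff Z2).
Proof.
rewrite /sym_A /union_A !map_col_mx [in LHS]map_row_mx.
rewrite -map_sym_Abar; move: sym_Abar => Ab.
rewrite !map_row_mx !map_z !map_one.
do 3?congr col_mx; do ?congr row_mx.
- by apply/matrixP => i j; rewrite !mxE v_in1.
- by apply/matrixP => i j; rewrite !mxE (ord1 j) v_opp_half_b1.
- by apply/matrixP => i j; rewrite !mxE v_in2.
- by apply/matrixP => i j; rewrite !mxE (ord1 j) v_half_b2.
Qed.

Let map_sym_R : map_mx v sym_R = map_mx natr (union_R (cexpo Z1) (cexpo Z2)).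
Proof.
rewrite /sym_R /union_R; move: (Rhat p1 p2) (Rbar p1 p2) => Rh Rb.
rewrite !map_row_mx !map_cst; congr (row_mx _ (row_mx _ _)).
rewrite !map_col_mx !map_row_mx !map_z !map_one !map_natr0 map_natr1.
congr (col_mx _ (col_mx _ (col_mx (row_mx _ (row_mx _ _)) (row_mx _ (row_mx _ _))))).
  by apply/matrixP => i j; rewrite !mxE v_in1.
by apply/matrixP => i j; rewrite !mxE v_in2.
Qed.

Lemma map_sym_union : map_rep v v sym_union =
  map_rep id natr (cpz_union Z1 Z2).
Proof.
rewrite /map_rep /= map_sym_E map_sym_A map_sym_R !map_mx_id //.
congr Rep.
- by apply/colP => i; rewrite !mxE v_half_sum.
- rewrite !map_row_mx; congr (row_mx _ (row_mx _ _)); apply/matrixP => i j.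
  + by rewrite !mxE (ord1 j) v_half_diff.
  + by rewrite !mxE v_in1.
  + by rewrite !mxE v_in2.
- rewrite /union_b !map_col_mx map_z map_one.
  do 3?congr col_mx; apply/colP => i.
    by rewrite !mxE v_half_b1.
  by rewrite !mxE v_half_b2.
Qed.

End Valuation.

Lemma represents_union : represents inp vals2 sym_union (cpz_union Z1 Z2).
Proof.
have [u1E u2E u12E m1E] := oval_consts.
have ou1 : oval inp vals2 opp_u1 = - (1 / (2 * p1%:R)).
  by rewrite oval_res2 /instr_val /= sub0r [nth _ _ _]oval_vals1 /instr_val /= natrM.
have ou2 : oval inp vals2 opp_u2 = - (1 / (2 * p2%:R)).
  by rewrite oval_res2 /instr_val /= sub0r [nth _ _ _]oval_vals1 /instr_val /= natrM.
have ou12 : oval inp vals2 opp_u12 = - (1 / (4 * p1%:R * p2%:R)).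
  by rewrite oval_res2 /instr_val /= sub0r [nth _ _ _]oval_vals1 /instr_val /= !natrM.
have hs i : oval inp vals2 (half_sum i) = 1 / 2 * (center Z1 i 0 + center Z2 i 0).
  rewrite oval_res2 /instr_val /= [nth _ _ _]oval_vals1 /instr_val /=; ring.
have hd i : oval inp vals2 (half_diff i) = 1 / 2 * (center Z1 i 0 - center Z2 i 0).
  rewrite oval_res2 /instr_val /= [nth _ _ _]oval_vals1 /instr_val /=; ring.
have hb1 i : oval inp vals2 (half_b1 i) = 1 / 2 * coff Z1 i 0.
  by rewrite oval_res1 /instr_val /= mul1r mulrC.
have hb2 i : oval inp vals2 (half_b2 i) = 1 / 2 * coff Z2 i 0.
  by rewrite oval_res1 /instr_val /= mul1r mulrC.
have ohb1 i : oval inp vals2 (opp_half_b1 i) = - (1 / 2) * coff Z1 i 0.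
  rewrite oval_res2 /instr_val /= [nth _ _ _]oval_vals1 /instr_val /=; ring.
exact: map_sym_union.
Qed.

Lemma supp_row_mx (T : Type) a b c (A : 'M[operand T]_(a, b))
    (B : 'M_(a, c)) r i :
  ~~ is_zero (row_mx A B r i) ->
  (exists2 i', i = lshift c i' & ~~ is_zero (A r i')) \/
  (exists2 i', i = rshift b i' & ~~ is_zero (B r i')).
Proof.
case: (split_ordP i) => i' ->; rewrite ?row_mxEl ?row_mxEr; first by left; exists i'.
by right; exists i'.
Qed.

Lemma supp_zero a b (r : 'I_a) (i : 'I_b) :
  ~~ is_zero ((z : 'M[op]_(a, b)) r i) -> False.
Proof. by rewrite mxE. Qed.

(** Row by row: the first row has one nonconstant column; the second lives on [Rbar], whose columns
    are distinct; each remaining row lives on [R1] or [R2] and on the last column, whose first entry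
    is 1 while theirs is 0. *)
Lemma sym_A_uniq (R1 : 'M_(p1, q1)) (R2 : 'M_(p2, q2)) r i j :
  distinct_nonzero_cols R1 -> distinct_nonzero_cols R2 ->
  ~~ is_zero (sym_A r i) -> ~~ is_zero (sym_A r j) ->
  col i (union_R R1 R2) = col j (union_R R1 R2) -> i = j.
Proof.
move=> [R1inj _] [R2inj _]; rewrite /sym_A.
have colE := (colKl, colKr, col_col_mx, col0, col_const).
have neq01 (x : 'I_1) : (0 : 'cV[nat]_1) <> const_mx 1%N.
  by move=> /matrixP/(_ 0 0); rewrite !mxE.
case: (split_ordP r) => {r} r ->; rewrite ?col_mxEu ?col_mxEd.
  have row0 k : ~~ is_zero ((const_mx (cst 1) <|> z <|> z <|> z <|> z) r k) ->
      exists k', k = lshift _ k'.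
    move=> /supp_row_mx[[k' -> _]|[k1 _]]; first by exists k'.
    move=> /supp_row_mx[[k2 _ /supp_zero[]]|[k2 _]].
    move=> /supp_row_mx[[k3 _ /supp_zero[]]|[k3 _]].
    by move=> /supp_row_mx[[k4 _ /supp_zero[]]|[k4 _ /supp_zero[]]].
  by move=> /row0[i' ->] /row0[j' ->]; rewrite !ord1.
case: (split_ordP r) => {r} r ->; rewrite ?col_mxEu ?col_mxEd.
  have row1 k : ~~ is_zero ((z <|> sym_Abar <|> z <|> z <|> z) r k) ->
      exists k', k = rshift 1 (lshift _ k').
    move=> /supp_row_mx[[k' _ /supp_zero[]]|[k' ->]].
    move=> /supp_row_mx[[l -> _]|[l _]]; first by exists l.
    move=> /supp_row_mx[[k2 _ /supp_zero[]]|[k2 _]].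
    by move=> /supp_row_mx[[k3 _ /supp_zero[]]|[k3 _ /supp_zero[]]].
  move=> /row1[i' ->] /row1[j' ->]; rewrite /union_R !colKr !colKl.
  by move/colinj_Rbar ->.
case: (split_ordP r) => {r} r ->; rewrite ?col_mxEu ?col_mxEd.
  have row2 k : ~~ is_zero ((z <|> z <|> (\matrix_(k, j) in1 (Cgens _ _ _ k j)) <|> z
         <|> \col_k opp_half_b1 k) r k) ->
      (exists k', k = rshift 1 (rshift _ (lshift _ k'))) \/
      (exists k', k = rshift 1 (rshift _ (rshift _ (rshift _ k')))).
    move=> /supp_row_mx[[k' _ /supp_zero[]]|[k1 ->]].
    move=> /supp_row_mx[[k'' _ /supp_zero[]]|[k'' ->]].
    move=> /supp_row_mx[[l -> _]|[l ->]]; first by left; exists l.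
    move=> /supp_row_mx[[l' _ /supp_zero[]]|[l' -> _]].
    by right; exists l'.
  move=> /row2[[i' ->]|[i' ->]] /row2[[j' ->]|[j' ->]];
    rewrite /union_R !colKr !colE; last by rewrite !ord1.
  - by move=> /eq_col_mx[_ /eq_col_mx[_ /eq_col_mx[/R1inj -> _]]].
  - by move=> /eq_col_mx[/(neq01 ord0)].
  - by move=> /eq_col_mx[/esym/(neq01 ord0)].
have row3 k : ~~ is_zero ((z <|> z <|> z <|> (\matrix_(k, j) in2 (Cgens _ _ _ k j))
         <|> \col_k half_b2 k) r k) ->
    (exists k', k = rshift 1 (rshift _ (rshift _ (lshift _ k')))) \/
    (exists k', k = rshift 1 (rshift _ (rshift _ (rshift _ k')))).
  move=> /supp_row_mx[[k' _ /supp_zero[]]|[k1 ->]].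
  move=> /supp_row_mx[[k'' _ /supp_zero[]]|[k'' ->]].
  move=> /supp_row_mx[[k3 _ /supp_zero[]]|[k3 ->]].
  move=> /supp_row_mx[[l -> _]|[l -> _]]; first by left; exists l.
  by right; exists l.
move=> /row3[[i' ->]|[i' ->]] /row3[[j' ->]|[j' ->]];
  rewrite /union_R !colKr !colE; last by rewrite !ord1.
- by move=> /eq_col_mx[_ /eq_col_mx[_ /eq_col_mx[_ /R2inj ->]]].
- by move=> /eq_col_mx[/(neq01 ord0)].
- by move=> /eq_col_mx[/esym/(neq01 ord0)].
Qed.

End Run.
End Algorithm.

(** * Correctness and cost of the algorithm *)

Definition union_alg : union_algorithm := union_prog.

Lemma union_alg_correct (R : realType) : computes_union_and_merges R union_alg.
Proof.
move=> n p1 h1 m1 q1 p2 h2 m2 q2 Z1 Z2 reg1 reg2.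
rewrite /run_union run_union_prog //=; split; first exact: represents_union.
have [g1 g2 _] := guess_answers reg1 reg2.
exists (merge_with (guess_col (answers Z1 Z2)) (cpz_union Z1 Z2)); split.
  by apply: merged_merge_with => i j; exact: guess_colE.
apply: (@represents_sym_merge R _ _ _ _ _ _ _ _ _ (guess_col (answers Z1 Z2))
  (sym_union n p1 h1 m1 q1 p2 h2 m2 q2)); last exact: represents_union.
(* Uniqueness is about the guessed columns; [g1] and [g2] provide the hypotheses. *)
by move=> r i j; apply: sym_A_uniq.
Qed.

Lemma cost_union_alg (R : realType) n p1 h1 m1 q1 p2 h2 m2 q2
    (Z1 : cpz R n p1 h1 m1 q1) (Z2 : cpz R n p2 h2 m2 q2) :
  regular Z1 -> regular Z2 ->
  cost (run_union union_alg Z1 Z2) =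
  (7 + 4 * n + 2 * m1 + m2 + 3 * (p1 * q1 + p2 * q2))%N.
Proof.
by move=> reg1 reg2; rewrite /run_union run_union_prog //= union_costE.
Qed.

Lemma ln2_gt0 (R : realType) : 0 < ln 2%:R :> R.
Proof. by rewrite ln_gt0 // ltr1n. Qed.

(** The ratio [ln k / ln 2] is at least 1 for [k] at least 2, so a bound without logarithm
    suffices. *)
Lemma ler_mul_ln (R : realType) (a b : R) (k : nat) :
  0 <= b -> (1 < k)%N -> a <= b -> a <= b / ln 2%:R * ln k%:R.
Proof.
move=> b0 k1 ab; apply: (le_trans ab); rewrite mulrAC ler_pdivlMr ?ln2_gt0 //.
by rewrite ler_wpM2l // ler_ln ?posrE ?ltr0n ?ler_nat // (ltn_trans _ k1).
Qed.

Theorem theorem1 (R : realType) :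
  (forall (n p1 h1 m1 q1 p2 h2 m2 q2 : nat)
     (Z1 : cpz R n p1 h1 m1 q1) (Z2 : cpz R n p2 h2 m2 q2),
     regular Z1 -> regular Z2 ->
     cpz_set Z1 `|` cpz_set Z2 = cpz_set (cpz_union Z1 Z2)) /\
  exists alg : union_algorithm,
    [/\ computes_union_and_merges R alg,
        (exists C : R,
           forall (n p1 h1 m1 q1 p2 h2 m2 q2 : nat)
             (Z1 : cpz R n p1 h1 m1 q1) (Z2 : cpz R n p2 h2 m2 q2),
           regular Z1 -> regular Z2 ->
           let mu1 := rep_size n p1 h1 m1 q1 in
           let mu2 := rep_size n p2 h2 m2 q2 in
           (1 < mu1 * mu2)%N ->
           (cost (run_union alg Z1 Z2))%:R <=
             C * ((mu1 + mu2) * mu1 * mu2)%:R * ln (mu1 * mu2)%:R) &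
        (forall kp1 kh1 km1 kq1 kp2 kh2 km2 kq2 : R,
           exists C : R,
           forall (n p1 h1 m1 q1 p2 h2 m2 q2 : nat)
             (Z1 : cpz R n p1 h1 m1 q1) (Z2 : cpz R n p2 h2 m2 q2),
           regular Z1 -> regular Z2 ->
           p1%:R = kp1 * n%:R -> h1%:R = kh1 * n%:R ->
           m1%:R = km1 * n%:R -> q1%:R = kq1 * n%:R ->
           p2%:R = kp2 * n%:R -> h2%:R = kh2 * n%:R ->
           m2%:R = km2 * n%:R -> q2%:R = kq2 * n%:R ->
           (1 < n)%N ->
           (cost (run_union alg Z1 Z2))%:R <= C * (n ^ 3)%:R * ln n%:R)].
Proof.
split; first exact: cpz_union_setE.
exists union_alg; split; first exact: union_alg_correct.
(* The cost is at most 7 + 4 mu1 + 3 mu2, which 8 (mu1 + mu2) dominates because both sizes are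
   positive. *)
- exists (8 / ln 2%:R) => n p1 h1 m1 q1 p2 h2 m2 q2 Z1 Z2 reg1 reg2 mu1 mu2 mu12.
  rewrite cost_union_alg //.
  rewrite [X in _ <= X](_ : _ = 8 * ((mu1 + mu2) * mu1 * mu2)%:R / ln 2%:R
    * ln (mu1 * mu2)%:R); last by ring.
  apply: ler_mul_ln => //; first by rewrite mulr_ge0.
  rewrite -natrM ler_nat.
  have [mu1_gt0 mu2_gt0] : (0 < mu1)%N /\ (0 < mu2)%N.
    by apply/andP; rewrite -muln_gt0 ltnW.
  have n_mu1 : (n + m1 + p1 * q1 <= mu1)%N by rewrite /mu1 /rep_size; nia.
  have mu2_ge : (m2 + p2 * q2 <= mu2)%N by rewrite /mu2 /rep_size; nia.
  have : (mu1 + mu2 <= (mu1 + mu2) * mu1 * mu2)%N.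
    by rewrite -mulnA leq_pmulr // muln_gt0 mu1_gt0.
  lia.
- move=> kp1 kh1 km1 kq1 kp2 kh2 km2 kq2.
  (* 11 collects the constant 7 and the term [4 * n]. Absolute values appear because the ratios are
     arbitrary reals. *)
  pose K := 11 + 2 * `|km1| + `|km2| + 3 * (`|kp1 * kq1| + `|kp2 * kq2|).
  exists (K / ln 2%:R) => n p1 h1 m1 q1 p2 h2 m2 q2 Z1 Z2 reg1 reg2.
  move=> p1E _ m1E q1E p2E _ m2E q2E n1.
  have K0 : 0 <= K by rewrite /K !addr_ge0 ?mulr_ge0 ?addr_ge0.
  rewrite cost_union_alg //.
  rewrite [X in _ <= X](_ : _ = K * (n ^ 3)%:R / ln 2%:R * ln n%:R); last by ring.
  apply: ler_mul_ln => //; first by rewrite mulr_ge0.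
  rewrite !(natrD, natrM, natrX) m1E m2E p1E p2E q1E q2E.
  set x : R := n%:R.
  have x1 : 1 <= x by rewrite ler1n ltnW.
  have x0 : 0 <= x by exact: le_trans x1.
  have xx3 : x <= x ^+ 3 by rewrite -[leLHS]expr1 ler_weXn2l.
  have x23 : x ^+ 2 <= x ^+ 3 by rewrite ler_weXn2l.
  have x3 : 1 <= x ^+ 3 by exact: le_trans xx3.
  have bound (k y : R) : 0 <= y -> y <= x ^+ 3 -> k * y <= `|k| * x ^+ 3.
    move=> y0 yx; apply: le_trans (ler_wpM2l (normr_ge0 k) yx).
    by rewrite ler_wpM2r // ler_norm.
  have bm1 := bound km1 _ x0 xx3; have bm2 := bound km2 _ x0 xx3.
  have b1 := bound (kp1 * kq1) _ (exprn_ge0 2 x0) x23.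
  have b2 := bound (kp2 * kq2) _ (exprn_ge0 2 x0) x23.
  rewrite /K; lra.
Qed.
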